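(* Let $\alpha$ be a badly-approximable real number with continued fraction convergents $p_j/q_j$, and let $X=\{\sqrt{n}\,e^{2\pi i\alpha n} : n\in\mathbb{N}\}\subseteq\mathbb{C}\cong\mathbb{R}^2$ be the Fermat spiral with angle difference $\alpha$. Let $\mathcal{L}\subseteq\mathbb{R}^3$ be the set of all triples $(\beta,c,\tilde c)$ that are the limit of some subsequence of $$\bigl(q_{j+1}/q_j,\ q_j(q_j\alpha-p_j),\ q_{j+1}(q_{j+1}\alpha-p_{j+1})\bigr)_j .$$ Then the Chabauty limits of $X$ are precisely the translates of the lattices $$\Lambda=\sqrt{\pi}\,R\,A_t\begin{bmatrix}1&\beta\\ c&\tilde c/\beta\end{bmatrix}\mathbb{Z}^2,$$ where $(\beta,c,\tilde c)$ ranges over $\mathcal{L}$, $R$ over all $2\times 2$ rotation matrices, and $t$ over all positive reals, with $A_t=\begin{bmatrix}t&0\\0&1/t\end{bmatrix}$.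
   Context: A number $\alpha\notin\mathbb{Q}$ with continued fraction convergents $p_j/q_j$ is badly-approximable if $0<c_\alpha:=\liminf_j q_j|q_j\alpha-p_j|$. The Chabauty–Fell topology on the set of closed subsets of $\mathbb{R}^d$ is given by the metric $d(A,B)=\min\{1,\Delta(A,B)\}$, where $\Delta(A,B)=\inf\{\epsilon>0 : B_{1/\epsilon}(0)\cap A\subseteq\mathcal{N}_\epsilon(B),\ B_{1/\epsilon}(0)\cap B\subseteq\mathcal{N}_\epsilon(A)\}$, $\mathcal{N}_\epsilon(A)=\bigcup_{x\in A}B_\epsilon(x)$, and $B_r(x)$ is the Euclidean ball. A Chabauty limit of a closed set $X\subseteq\mathbb{R}^d$ is the limit (if it exists), in this topology, of $T_nX$ for a sequence $T_n$ of translations of $\mathbb{R}^d$ with $T_n(0)\to\infty$. Vectors in $\mathbb{Z}^2$ and $\mathbb{R}^2$ are column vectors. *)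

(* Defs.v *)
From HB Require Import structures.
From mathcomp Require Import all_boot all_order all_algebra.
From mathcomp Require Import all_classical all_reals all_analysis.
Set Implicit Arguments.
Unset Strict Implicit.
Unset Printing Implicit Defensive.
Import Order.TTheory GRing.Theory Num.Theory.
Import numFieldNormedType.Exports.
Local Open Scope classical_set_scope.
Local Open Scope ring_scope.

(* Complete quotients; for irrational alpha they are never integers, so that
   the inverse is always taken of a nonzero number. *)
Fixpoint cf_quotient (R : realType) (alpha : R) (j : nat) : R :=
  if j is k.+1 then
    (cf_quotient alpha k - (Num.floor (cf_quotient alpha k))%:~R)^-1
  else alpha.

Definition cf_digit (R : realType) (alpha : R) (j : nat) : int :=
  Num.floor (cf_quotient alpha j).

(* Numerators and denominators of the convergents p_j / q_j, j >= 0, of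
   [a_0; a_1, a_2, ...]; p_0 = a_0 and q_0 = 1. *)
Fixpoint cvgt_num (R : realType) (alpha : R) (j : nat) : int :=
  match j with
  | 0 => cf_digit alpha 0
  | 1 => cf_digit alpha 1 * cf_digit alpha 0 + 1
  | (k.+1 as k').+1 =>
      cf_digit alpha k'.+1 * cvgt_num alpha k' + cvgt_num alpha k
  end.

Fixpoint cvgt_den (R : realType) (alpha : R) (j : nat) : int :=
  match j with
  | 0 => 1
  | 1 => cf_digit alpha 1
  | (k.+1 as k').+1 =>
      cf_digit alpha k'.+1 * cvgt_den alpha k' + cvgt_den alpha k
  end.

Definition badly_approximable (R : realType) (alpha : R) : Prop :=
  irrational alpha /\
  (0 < limn_einf (fun j : nat =>
     ((cvgt_den alpha j)%:~R *
      `|(cvgt_den alpha j)%:~R * alpha - (cvgt_num alpha j)%:~R|)%:E))%E.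

(* The library norm on matrices is the sup norm, hence this definition. *)
Definition eucl_norm (R : realType) (d : nat) (x : 'cV[R]_d) : R :=
  Num.sqrt (\sum_(i < d) x i 0 ^+ 2).

Definition eucl_ball (R : realType) (d : nat) (x : 'cV[R]_d) (r : R) :
    set 'cV[R]_d :=
  [set y | eucl_norm (y - x) < r].

Definition thickening (R : realType) (d : nat) (eps : R) (A : set 'cV[R]_d) :
    set 'cV[R]_d :=
  \bigcup_(x in A) eucl_ball x eps.

(* Extended-real valued: the infimum of the empty set is +oo. *)
Definition chabauty_Delta (R : realType) (d : nat) (A B : set 'cV[R]_d) :
    \bar R :=
  ereal_inf [set eps%:E | eps in [set eps : R |
    [/\ 0 < eps,
        eucl_ball 0 (1 / eps) `&` A `<=` thickening eps B &
        eucl_ball 0 (1 / eps) `&` B `<=` thickening eps A]]].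

Definition chabauty_dist (R : realType) (d : nat) (A B : set 'cV[R]_d) : R :=
  fine (mine 1 (chabauty_Delta A B))%E.

Definition translate (R : realType) (d : nat) (v : 'cV[R]_d)
    (A : set 'cV[R]_d) : set 'cV[R]_d :=
  [set v + x | x in A].

(* T_n is the translation by v n, so that T_n(0) = v n. The distance is only
   meaningful on closed sets, hence the first two conditions. *)
Definition chabauty_limit (R : realType) (d : nat) (X Y : set 'cV[R]_d) :
    Prop :=
  [/\ closed X, closed Y &
      exists v : nat -> 'cV[R]_d,
        eucl_norm (v n) @[n --> \oo] --> +oo /\
        chabauty_dist (translate (v n) X) Y @[n --> \oo] --> (0 : R)].

Definition mx22 (R : realType) (a b c d : R) : 'M[R]_2 :=
  \matrix_(i < 2, j < 2)
    if i == 0 then (if j == 0 then a else b) else (if j == 0 then c else d).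

Definition rotation_mx (R : realType) (theta : R) : 'M[R]_2 :=
  mx22 (cos theta) (- sin theta) (sin theta) (cos theta).

Definition lattice_of (R : realType) (M : 'M[R]_2) : set 'cV[R]_2 :=
  [set M *m map_mx (fun k : int => k%:~R) z | z in [set: 'cV[int]_2]].

(* The point r e^(i phi) of C, seen in R^2. *)
Definition polar (R : realType) (r phi : R) : 'cV[R]_2 :=
  \col_(i < 2) if i == 0 then r * cos phi else r * sin phi.

Definition fermat_spiral (R : realType) (alpha : R) : set 'cV[R]_2 :=
  [set polar (Num.sqrt n%:R) (2 * pi * alpha * n%:R) | n in [set: nat]].

Definition cvgt_triple (R : realType) (alpha : R) (j : nat) : R * R * R :=
  let p i : R := (cvgt_num alpha i)%:~R in
  let q i : R := (cvgt_den alpha i)%:~R in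
  (q j.+1 / q j, q j * (q j * alpha - p j),
   q j.+1 * (q j.+1 * alpha - p j.+1)).

Definition cvgt_limit_set (R : realType) (alpha : R) : set (R * R * R) :=
  [set l | exists k : nat -> nat,
     increasing_seq k /\ cvgt_triple alpha (k n) @[n --> \oo] --> l].

Definition spiral_lattice (R : realType) (theta t beta c c' : R) :
    set 'cV[R]_2 :=
  lattice_of (Num.sqrt pi *:
    (rotation_mx theta *m mx22 t 0 0 (1 / t) *m mx22 1 beta c (c' / beta))).

(* Main.v *)
Require Import Defs.
From HB Require Import structures.
From mathcomp Require Import all_boot all_order all_algebra.
From mathcomp Require Import all_classical all_reals all_analysis.
From mathcomp Require Import ring lra zify.
Import Order.TTheory GRing.Theory Num.Theory.
Import numFieldNormedType.Exports.
Local Open Scope classical_set_scope.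
Local Open Scope ring_scope.
Set Implicit Arguments.
Unset Strict Implicit.
Unset Printing Implicit Defensive.

(** Far from the origin the Fermat spiral looks like a lattice of covolume
    pi. Put a frame at u = r e^(i phi) with r large, pointing in the direction
    of u. The points of the spiral near u are the sqrt(m) e^(2 pi i alpha m)
    with m close to r^2, and if k is the integer nearest to
    alpha m - phi / (2 pi), then the coordinates of such a point in the frame
    are, up to an error tending to 0 as r tends to infinity,
      (m - r^2) / (2 r)   and   r (2 pi (alpha m - k) - phi).
    These are affine functions of (m, k) in Z^2 [polar_chart_cvg], and
    conversely a point within a fixed distance of u has bounded coordinates
    [polar_chart_proper].

    The linear part of this map is badly conditioned in the standard basis of
    Z^2, but consecutive convergents (q_j, p_j), (q_{j+1}, p_{j+1}) also form a
    basis of Z^2. With t = q_j / (2 r sqrt pi), that basis turns the linear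
    part into exactly sqrt pi A_t M_j, where M_j is the matrix of the theorem
    formed from the j-th triple [chart_matrixE]; its determinant is pi or - pi
    [chart_det]. So if r tends to infinity while the triples, t, phi and the
    offset of the affine map converge, the translates of the spiral by - u
    converge to a translate of the limiting lattice [spiral_patch_cvg]:
    pointwise convergence of the parametrisations by Z^2, with only finitely
    many parameters relevant to each bounded region, is enough
    [range_local_cvg].

    Bad approximability says that q_{j+1} / q_j is bounded
    [cvgt_den_ratio_bounded]. Hence every large r lies between q_j and q_{j+1}
    for some j, which keeps t in a compact subset of the positive reals; all
    the data are then bounded and Bolzano-Weierstrass applies
    [spiral_patch_subseq]. A given Chabauty limit is therefore also the limit
    of a subsequence of the required form, and limits are unique
    [chabauty_limit_is_lattice]. Conversely, for a limit triple along j = k(n),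
    taking r = q_{k(n)} / (2 t sqrt pi) makes t constant, and a bounded
    correction of the translations produces any prescribed offset
    [lattice_is_chabauty_limit]. *)

(** * Continued fractions *)

(** One step of the continued fraction algorithm; by induction no complete
    quotient is ever an integer, so the algorithm never divides by 0. *)
Lemma irrational_inv_frac (R : realType) (x : R) (n : int) :
  irrational x -> irrational (x - n%:~R)^-1.
Proof.
move=> xirr [q _ qx]; apply: xirr; exists (q^-1 + n%:~R) => //.
by rewrite rmorphD fmorphV /= ratr_int qx invrK subrK.
Qed.

Lemma cf_quotient_irrational (R : realType) (alpha : R) (j : nat) :
  irrational alpha -> irrational (cf_quotient alpha j).
Proof. by move=> airr; elim: j => //= j; exact: irrational_inv_frac. Qed.

Lemma cf_frac_itv (R : realType) (alpha : R) (j : nat) : irrational alpha ->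
  0 < cf_quotient alpha j - (cf_digit alpha j)%:~R < 1.
Proof.
move=> /cf_quotient_irrational-/(_ j) xirr; rewrite /cf_digit.
move: (cf_quotient alpha j) xirr => x xirr.
have /andP[xge xlt] := floor_itv x.
rewrite subr_gt0 ltrBlDr addrC -intrD1 xlt andbT lt_neqAle xge andbT.
by apply/eqP => xn; apply: xirr; exists (Num.floor x)%:~R; rewrite ?ratr_int.
Qed.

Lemma cf_quotientS_gt1 (R : realType) (alpha : R) (j : nat) :
  irrational alpha -> 1 < cf_quotient alpha j.+1.
Proof.
by move=> /cf_frac_itv-/(_ j)/andP[x0 x1]; rewrite /= invf_gt1.
Qed.

Lemma cf_digitS_ge1 (R : realType) (alpha : R) (j : nat) :
  irrational alpha -> 1 <= cf_digit alpha j.+1.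
Proof.
move=> /cf_quotientS_gt1-/(_ j) /ltW.
by rewrite /cf_digit floor_ge_int.
Qed.

Lemma cvgt_denSS (R : realType) (alpha : R) (j : nat) : cvgt_den alpha j.+2 =
  cf_digit alpha j.+2 * cvgt_den alpha j.+1 + cvgt_den alpha j.
Proof. by []. Qed.

Lemma cvgt_numSS (R : realType) (alpha : R) (j : nat) : cvgt_num alpha j.+2 =
  cf_digit alpha j.+2 * cvgt_num alpha j.+1 + cvgt_num alpha j.
Proof. by []. Qed.

Lemma cvgt_den_nondecreasing (R : realType) (alpha : R) (j : nat) :
  irrational alpha -> 1 <= cvgt_den alpha j <= cvgt_den alpha j.+1.
Proof.
move=> airr; elim: j => [|j /andP[IH1 IH2]]; first exact: cf_digitS_ge1.
have := cf_digitS_ge1 j.+1 airr.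
rewrite (le_trans IH1 IH2) cvgt_denSS andTb.
move: IH1 IH2; set q := cvgt_den _ j; set q' := cvgt_den _ j.+1.
by move: (cf_digit _ _) q q' => a q q'; nia.
Qed.

Lemma cvgt_den_ge1 (R : realType) (alpha : R) (j : nat) : irrational alpha ->
  1 <= (cvgt_den alpha j)%:~R :> R.
Proof.
by move=> airr; have /andP[q1 _] := cvgt_den_nondecreasing j airr; rewrite ler1z.
Qed.

Lemma cvgt_den_ge (R : realType) (alpha : R) (j : nat) :
  irrational alpha -> j%:Z <= cvgt_den alpha j.
Proof.
move=> airr; case: j => //; elim=> [|j IH]; first exact: cf_digitS_ge1.
have := cf_digitS_ge1 j.+1 airr.
have /andP[] := cvgt_den_nondecreasing j airr.
move: IH; rewrite cvgt_denSS.
set q := cvgt_den _ j; set q' := cvgt_den _ j.+1.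
by move: (cf_digit _ _) q q' => a q q'; nia.
Qed.

(** The signed error of the j-th convergent, to which the second and third
    entries of the triples are proportional. *)
Definition cvgt_err (R : realType) (alpha : R) (j : nat) : R :=
  (cvgt_den alpha j)%:~R * alpha - (cvgt_num alpha j)%:~R.

Lemma cvgt_det (R : realType) (alpha : R) (j : nat) :
  cvgt_den alpha j * cvgt_num alpha j.+1 -
    cvgt_den alpha j.+1 * cvgt_num alpha j = (-1) ^+ j.
Proof.
elim: j => [|j IH]; first by rewrite /=; ring.
by rewrite exprS -IH cvgt_denSS cvgt_numSS; ring.
Qed.

Lemma cvgt_err_det (R : realType) (alpha : R) (j : nat) :
  (cvgt_den alpha j)%:~R * cvgt_err alpha j.+1 -
    (cvgt_den alpha j.+1)%:~R * cvgt_err alpha j = - (-1) ^+ j.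
Proof.
have := congr1 (fun z : int => z%:~R : R) (cvgt_det alpha j).
rewrite rmorphXn/= rmorphB/= !rmorphM/= => <-; rewrite /cvgt_err.
ring.
Qed.

(** The classical identity
    alpha = (x p_{j+1} + p_j) / (x q_{j+1} + q_j), with x the complete quotient
    of index j + 2, after clearing denominators. *)
Lemma cvgt_err_quotient (R : realType) (alpha : R) (j : nat) :
  irrational alpha ->
  cf_quotient alpha j.+2 * cvgt_err alpha j.+1 + cvgt_err alpha j = 0.
Proof.
move=> airr; elim: j => [|j IH].
  have /andP[x0 _] := cf_frac_itv 0 airr.
  have /andP[x1 _] := cf_frac_itv 1 airr.
  move: x0 x1; rewrite /cvgt_err /= -/(cf_digit alpha 0).
  rewrite -[Num.floor (_ ^-1)]/(cf_digit alpha 1).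
  set a0 : R := (cf_digit alpha 0)%:~R; set a1 := cf_digit alpha 1.
  move=> x0 x1; rewrite intrD1 intrM -/a0 mul1r; field.
  suff: 0 < 1 - a1%:~R * (alpha - a0) by move=> h; rewrite !gt_eqF//; nra.
  have -> : 1 - a1%:~R * (alpha - a0) =
      ((alpha - a0)^-1 - a1%:~R) * (alpha - a0) by field; rewrite gt_eqF.
  exact: mulr_gt0.
have /andP[x0 _] := cf_frac_itv j.+2 airr.
have -> : cvgt_err alpha j.+2 =
    (cf_digit alpha j.+2)%:~R * cvgt_err alpha j.+1 + cvgt_err alpha j.
  by rewrite /cvgt_err cvgt_denSS cvgt_numSS !intrD !intrM; ring.
rewrite -[cf_quotient alpha j.+3]/(cf_quotient alpha j.+2 -
  (cf_digit alpha j.+2)%:~R)^-1.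
have {IH} -> : cvgt_err alpha j = - (cf_quotient alpha j.+2 * cvgt_err alpha j.+1).
  by apply/eqP; rewrite -addr_eq0 addrC IH.
by field; rewrite gt_eqF.
Qed.

(** Consecutive errors have opposite signs and d_j = - x d_{j+1} with x > 1;
    inserted in the determinant identity this gives
    |d_{j+1}| (q_j + q_{j+1} x) = 1. *)
Lemma cvgt_err_le (R : realType) (alpha : R) (j : nat) : irrational alpha ->
  `|cvgt_err alpha j| * (cvgt_den alpha j.+1)%:~R <= 1.
Proof.
move=> airr.
have x1 := cf_quotientS_gt1 j.+1 airr.
have dd := cvgt_err_quotient j airr.
have det := cvgt_err_det alpha j.
have /andP[q1 qq] := cvgt_den_nondecreasing j airr.
rewrite -(ler_int R) in q1; rewrite -(ler_int R) in qq; move: q1 qq.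
move: (cf_quotient _ _) (cvgt_err _ j.+1) (cvgt_err _ j) x1 dd det.
move=> x d' d x1 dd.
have -> : d = - (x * d') by apply/eqP; rewrite -addr_eq0 addrC dd.
move: (cvgt_den _ j.+1)%:~R (cvgt_den _ j)%:~R => q' q det q1 qq.
have : `|d'| * (q + q' * x) = 1.
  rewrite -[q + _]ger0_norm; last nra.
  rewrite -normrM; have -> : d' * (q + q' * x) = - (-1) ^+ j by rewrite -det; ring.
  by rewrite normrN normrX normrN1 expr1n.
by rewrite normrN normrM (gtr0_norm (lt_trans _ x1))//; have := normr_ge0 d'; nra.
Qed.

(** The infimum of a tail is at most one of its terms, which are finite, so it
    is a real number, and it is positive for a late enough tail. *)
Lemma limn_einf_gt0_near (R : realType) (u : nat -> R) :
  (0 < limn_einf (fun n => (u n)%:E))%E ->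
  exists2 d : R, 0 < d & \forall n \near \oo, d <= u n.
Proof.
rewrite limn_einf_lim (cvg_lim _ (@cvg_einfs_sup _ _))//.
move=> /ereal_sup_gt[_ [N _ <-] eN].
have le_u n : (N <= n)%N -> (einfs (fun n => (u n)%:E) N <= (u n)%:E)%E.
  by move=> Nn; apply: ereal_inf_lbound; exists n.
have := le_u N (leqnn N); move: eN le_u; case: einfs => // d d0 le_u _.
by exists d => //; exists N => // n /= Nn; rewrite -lee_fin; exact: le_u.
Qed.

(** Since q_j |d_j| is eventually at least some d > 0 and
    |d_j| q_{j+1} <= 1, eventually q_{j+1} <= q_j / d; the finite sum takes care
    of the initial indices. *)
Lemma cvgt_den_ratio_bounded (R : realType) (alpha : R) :
  badly_approximable alpha -> exists B : R, forall j,
  (cvgt_den alpha j.+1)%:~R <= B * (cvgt_den alpha j)%:~R.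
Proof.
move=> [airr /limn_einf_gt0_near[d d0 [N _ dle]]].
have q_ge1 j := cvgt_den_ge1 j airr.
exists (d^-1 + \sum_(i < N) (cvgt_den alpha i.+1)%:~R) => j.
have q1 := q_ge1 j; have q'1 := q_ge1 j.+1.
have S0 : 0 <= \sum_(i < N) (cvgt_den alpha i.+1)%:~R :> R.
  by apply: sumr_ge0 => i _; rewrite (le_trans ler01).
have [jN|Nj] := ltnP j N.
  rewrite (le_trans (_ : _ <= \sum_(i < N) (cvgt_den alpha i.+1)%:~R)) //.
    rewrite (bigD1 (Ordinal jN)) // -[leLHS]addr0 lerD2l.
    by apply: sumr_ge0 => i _; rewrite (le_trans ler01).
  have := invr_gt0 d; rewrite d0; set S := \sum_(_ < _) _ in S0 *; nra.
have le1 := cvgt_err_le j airr.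
have := dle j Nj; rewrite -/(cvgt_err alpha j) => dq.
have dV : 0 < d^-1 by rewrite invr_gt0.
have -> : (cvgt_den alpha j.+1)%:~R =
  d^-1 * (d * (cvgt_den alpha j.+1)%:~R) :> R by rewrite mulKf// gt_eqF.
rewrite mulrDl.
set e := `|_| in le1 dq; set q := (cvgt_den _ j)%:~R in q1 dq *.
set q' := (cvgt_den _ j.+1)%:~R in q'1 le1 *.
have : d * q' <= q.
  apply: (@le_trans _ _ (q * e * q')); first by rewrite ler_pM2r//; lra.
  by rewrite -mulrA; nra.
by set S := \sum_(_ < _) _ in S0 *; nra.
Qed.

Lemma cvgt_den_homo (R : realType) (alpha : R) (i j : nat) :
  irrational alpha -> (i <= j)%N -> cvgt_den alpha i <= cvgt_den alpha j.
Proof.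
move=> airr; apply: (homo_leq _ le_trans) => // k.
by have /andP[_] := cvgt_den_nondecreasing k airr.
Qed.

Lemma cvgt_den_bracket (R : realType) (alpha r : R) : irrational alpha ->
  exists j, r < (cvgt_den alpha j.+1)%:~R /\
    (1 <= r -> (cvgt_den alpha j)%:~R <= r).
Proof.
move=> airr.
have [r1|r1] := ltP r 1.
  by exists 0%N; split; [exact: lt_le_trans (cvgt_den_ge1 1 airr)|rewrite leNgt r1].
have ex : exists k, r < (cvgt_den alpha k)%:~R.
  exists (Num.truncn r).+1; apply: lt_le_trans (truncnS_gt r) _.
  by rewrite -[leLHS]/((Num.truncn r).+1%:Z%:~R) ler_int cvgt_den_ge.
case: (ex_minnP ex) => -[|j] rq jmin; first by move: r1; rewrite leNgt rq.
exists j; split => // _; rewrite leNgt; apply/negP => /jmin.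
by rewrite ltnn.
Qed.

(** * Subsequences *)

Lemma increasing_seq_ge (f : nat -> nat) (n : nat) :
  increasing_seq f -> (n <= f n)%N.
Proof.
move=> /increasing_seqP fS; elim: n => // n IH; exact: leq_ltn_trans IH (fS n).
Qed.

Lemma increasing_seq_cvg_oo (f : nat -> nat) :
  increasing_seq f -> f n @[n --> \oo] --> \oo.
Proof.
move=> finc A [N _ NA]; exists N => // n /= Nn; apply: NA => /=.
exact: leq_trans Nn (increasing_seq_ge n finc).
Qed.

(** Bolzano-Weierstrass in R^k, one coordinate at a time. *)
Lemma bounded_subseq_cvg (R : realType) (k : nat) (u : nat -> nat -> R) :
  (forall i, (i < k)%N -> exists B, forall n, `|u i n| <= B) ->
  exists2 f : nat -> nat, increasing_seq f &
    forall i, (i < k)%N -> cvgn (u i \o f).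
Proof.
elim: k => [|k IH] ub; first by exists id.
have [f finc fcvg] := IH (fun i ik => ub i (ltnW ik)).
have [B uB] := ub k (ltnSn k).
have [|g ginc gcvg] := @bolzano_weierstrass R (u k \o f).
  by exists B; split; [exact: num_real|move=> x /ltW Bx n _; exact: le_trans (uB _) Bx].
exists (f \o g) => [m n|i]; first by rewrite /= finc -leEnat ginc.
rewrite ltnS leq_eqVlt => /predU1P[-> //|ik].
have /cvg_ex[l ul] := fcvg i ik; apply/cvg_ex; exists l.
by apply: (cvg_comp _ _ _ ul); exact: increasing_seq_cvg_oo.
Qed.

(** The subsequence is made of iterates of a function that moves each index to
    a later one with a larger value. *)
Lemma escaping_subseq (u : nat -> nat) (P : nat -> Prop) :
  (forall M, \forall n \near \oo, (M <= u n)%N) -> (\forall n \near \oo, P n) ->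
  exists g : nat -> nat,
    [/\ increasing_seq g, increasing_seq (u \o g) & forall n, P (g n)].
Proof.
move=> uoo Poo.
have /choice[h hP] :
    forall n, exists m, [/\ (n < m)%N, (u n < u m)%N & P m].
  move=> n.
  have [N1 _ N1P] := uoo (u n).+1; have [N2 _ N2P] := Poo.
  exists (maxn n.+1 (maxn N1 N2)); split; first exact: leq_maxl.
    by apply: N1P => /=; rewrite !leq_max leqnn orbT.
  by apply: N2P => /=; rewrite !leq_max leqnn !orbT.
exists (fun n => iter n.+1 h 0%N).
split; [apply/increasing_seqP => n|apply/increasing_seqP => n|move=> n].
- by have [] := hP (iter n.+1 h 0%N).
- by have [] := hP (iter n.+1 h 0%N).
- by have [] := hP (iter n h 0%N).
Qed.

(** * Closeness on bounded regions and the Chabauty metric *)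

(** Fell convergence without the coupling of the radius of the ball to the
    tolerance. It depends only on the topology of the norm, which permits using
    the sup norm of matrices in place of the Euclidean one. *)
Definition local_cvg (R : realType) (V : normedModType R) (A : nat -> set V)
    (Y : set V) : Prop :=
  forall D e : R, 0 < e -> \forall n \near \oo,
    (forall x, A n x -> `|x| < D -> exists2 y, Y y & `|x - y| < e) /\
    (forall y, Y y -> `|y| < D -> exists2 x, A n x & `|x - y| < e).

Lemma local_cvg_subset (R : realType) (V : normedModType R)
    (A : nat -> set V) (Y Y' : set V) :
  closed Y' -> local_cvg A Y -> local_cvg A Y' -> Y `<=` Y'.
Proof.
move=> cY' AY AY' y Yy; apply: cY' => B /nbhs_ballP[e /= e0 eB].
have e20 : 0 < e / 2 by rewrite divr_gt0.
have [N1 _ N1P] := AY (`|y| + 1) _ e20.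
have [N2 _ N2P] := AY' (`|y| + e) _ e20.
pose n := maxn N1 N2.
have [_ /(_ y Yy)[|x Ax xy]] := N1P n (leq_maxl _ _); first by rewrite ltrDl.
have [near_Y' _] := N2P n (leq_maxr _ _).
have [|y' Y'y' xy'] := near_Y' x Ax.
  have -> : x = y + (x - y) by rewrite [RHS]addrC subrK.
  by rewrite (le_lt_trans (ler_normD _ _))// ltrD2l; lra.
exists y'; split => //; apply: eB; rewrite -ball_normE /=.
have -> : y - y' = (x - y') - (x - y) by rewrite opprB [RHS]addrC subrKA.
by rewrite (le_lt_trans (ler_normB _ _))//; lra.
Qed.

Lemma local_cvg_unique (R : realType) (V : normedModType R)
    (A : nat -> set V) (Y Y' : set V) :
  closed Y -> closed Y' -> local_cvg A Y -> local_cvg A Y' -> Y = Y'.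
Proof. by move=> ? ? ? ?; apply/seteqP; split; exact: (@local_cvg_subset _ _ A). Qed.

Lemma local_cvg_subseq (R : realType) (V : normedModType R)
    (A : nat -> set V) (Y : set V) (f : nat -> nat) :
  increasing_seq f -> local_cvg A Y -> local_cvg (A \o f) Y.
Proof.
by move=> finc AY D e e0; exact: (increasing_seq_cvg_oo finc (AY D e e0)).
Qed.

Lemma closed_translate (R : realType) (d : nat) (w : 'cV[R]_d)
    (A : set 'cV[R]_d) : closed A -> closed (translate w A).
Proof.
move=> cA.
have -> : translate w A = (fun x => x - w) @^-1` A.
  apply/seteqP; split=> [_ [x Ax <-]|x Ax] /=; first by rewrite addrAC subrr add0r.
  by exists (x - w) => //; rewrite addrC subrK.
apply: preimage_closed => // x _.
apply: (@continuousB _ _ _ id (cst w)); [exact: cvg_id|exact: cst_continuous].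
Qed.

Lemma translateD (R : realType) (d : nat) (v w : 'cV[R]_d)
    (A : set 'cV[R]_d) : translate v (translate w A) = translate (v + w) A.
Proof.
rewrite /translate image_comp; congr image; apply/funext => x /=.
by rewrite addrA.
Qed.

Lemma local_cvg_translate (R : realType) (d : nat)
    (A : nat -> set 'cV[R]_d) (Y : set 'cV[R]_d) (w : 'cV[R]_d) :
  local_cvg A Y ->
  local_cvg (fun n => translate w (A n)) (translate w Y).
Proof.
move=> AY D e e0; apply: filterS (AY (D + `|w|) e e0) => n [H1 H2].
have tr (x : 'cV[R]_d) : `|w + x| < D -> `|x| < D + `|w|.
  move=> wx; have -> : x = (w + x) - w by rewrite addrAC subrr add0r.
  by rewrite (le_lt_trans (ler_normB _ _))// ltrD2r.
split=> _ [x xA <-] /tr; [move=> /(H1 _ xA)|move=> /(H2 _ xA)] => -[y yY xy].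
  by exists (w + y); [exists y|rewrite [w + x]addrC addrKA].
by exists (w + y); [exists y|rewrite [w + y]addrC addrKA].
Qed.

(** A point of the closure is adherent to the part of the set near it, which
    is finite, hence closed. *)
Lemma locally_finite_closed (R : realType) (V : normedModType R)
    (A : set V) :
  (forall D : R, exists s : seq V, forall x, A x -> `|x| < D -> x \in s) ->
  closed A.
Proof.
move=> Afin x clx; have [s sP] := Afin (`|x| + 1).
have fin_closed (F : set V) : finite_set F -> closed F.
  have := hausdorff_accessible (@norm_hausdorff _ V).
  by move=> /accessible_finite_set_closed; apply.
suff [] : (A `&` ball x 1) x by [].
apply: fin_closed => [|B xB].
  apply: sub_finite_set (finite_seq s) => y [Ay]; rewrite -ball_normE /= => xy.
  apply: sP => //; have -> : y = x - (x - y) by rewrite opprB [RHS]addrC subrK.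
  by rewrite (le_lt_trans (ler_normB _ _))// ltrD2l.
have [|y [Ay [By xy]]] := clx (B `&` ball x 1).
  by apply: filterI => //; exact: nbhsx_ballx.
by exists y.
Qed.

Lemma normr_le_eucl_norm (R : realType) (d : nat) (x : 'cV[R]_d) :
  `|x| <= eucl_norm x.
Proof.
rewrite [leLHS]/Num.Def.normr /= mx_normrE; apply: bigmax_le => [|[i j] _ /=].
  exact: sqrtr_ge0.
rewrite [j]ord1 -sqrtr_sqr ler_wsqrtr// (bigD1 i)//= lerDl.
by apply: sumr_ge0 => k _; exact: sqr_ge0.
Qed.

Lemma coord_le_normr (R : realType) (d : nat) (x : 'cV[R]_d) (i : 'I_d) :
  `|x i 0| <= `|x|.
Proof.
rewrite [leRHS]/Num.Def.normr /= mx_normrE.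
exact: (@le_bigmax _ _ _ 0 (fun ij : 'I_d * 'I_1 => `|x ij.1 ij.2|) (i, 0)).
Qed.

Lemma eucl_norm_le_normr (R : realType) (d : nat) (x : 'cV[R]_d) :
  eucl_norm x <= d%:R * `|x|.
Proof.
rewrite -[leRHS]ger0_norm ?mulr_ge0// -sqrtr_sqr ler_wsqrtr//.
apply: (@le_trans _ _ (\sum_(i < d) `|x| ^+ 2)).
  apply: ler_sum => i _; rewrite -[x i 0 ^+ 2]real_normK ?num_real//.
  by rewrite lerXn2r // ?nnegrE ?coord_le_normr.
rewrite sumr_const card_ord exprMn -[leLHS]mulr_natl ler_wpM2r ?sqr_ge0//.
by rewrite -natrX ler_nat; case: d {x} => // d; rewrite leq_pmulr.
Qed.

(** The Chabauty-Fell distance is the infimum of the e > 0 with this property,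
    cut off at 1. *)
Definition chabauty_close (R : realType) (d : nat) (e : R)
    (A B : set 'cV[R]_d) : Prop :=
  eucl_ball 0 (1 / e) `&` A `<=` thickening e B /\
  eucl_ball 0 (1 / e) `&` B `<=` thickening e A.

(** Enlarging the tolerance shrinks the ball in which points are tested, so
    the condition defining the distance is monotone; the distance is then
    controlled by a single tolerance. *)
Lemma chabauty_close_le (R : realType) (d : nat) (e e' : R)
    (A B : set 'cV[R]_d) :
  0 < e -> e <= e' -> chabauty_close e A B -> chabauty_close e' A B.
Proof.
move=> e0 ee'.
have sub (C D : set 'cV[R]_d) : eucl_ball 0 (1 / e) `&` C `<=` thickening e D ->
    eucl_ball 0 (1 / e') `&` C `<=` thickening e' D.
  move=> CD x [x0 Cx]; have [|y Dy xy] := CD x.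
    split=> //; apply: (lt_le_trans x0).
    by rewrite !div1r lef_pV2 ?posrE//; exact: lt_le_trans ee'.
  by exists y => //; exact: lt_le_trans ee'.
by move=> [AB BA]; split; exact: sub.
Qed.

Lemma chabauty_dist_lt (R : realType) (d : nat) (e : R) (A B : set 'cV[R]_d) :
  0 < e -> e <= 1 -> chabauty_dist A B < e -> chabauty_close e A B.
Proof.
move=> e0 e1 ABe.
have : (chabauty_Delta A B < e%:E)%E.
  rewrite ltNge; apply/negP => eD; move: ABe; apply/negP; rewrite -leNgt.
  rewrite /chabauty_dist /mine; case: ifPn => //.
  by case: (chabauty_Delta A B) eD => [r| |]; rewrite ?lee_fin ?ltry.
move=> /ereal_inf_lt[_ [e' [e'0 AB BA] <-]]; rewrite lte_fin => /ltW e'e.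
exact: (chabauty_close_le e'0 e'e).
Qed.

Lemma chabauty_dist_le (R : realType) (d : nat) (e : R) (A B : set 'cV[R]_d) :
  0 < e -> chabauty_close e A B -> 0 <= chabauty_dist A B <= e.
Proof.
move=> e0 [AB BA].
have D0 : (0 <= chabauty_Delta A B)%E.
  by apply: le_ereal_inf_tmp => _ [x [x0 _ _] <-]; rewrite lee_fin ltW.
have De : (chabauty_Delta A B <= e%:E)%E by apply: ereal_inf_lbound; exists e.
rewrite /chabauty_dist /mine; move: (chabauty_Delta A B) D0 De => [r| |] //=.
rewrite !lee_fin lte_fin => r0 re; case: ifPn => /=; last by rewrite r0.
by move=> /ltW r1; rewrite ler01 (le_trans r1).
Qed.

(** The bridge to the metric of the theorem. The constants absorb both the
    comparison of norms, |x| <= |x|_2 <= d |x|, and the coupling of the radius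
    1 / e to the tolerance e. *)
Lemma chabauty_cvgP (R : realType) (d : nat) (A : nat -> set 'cV[R]_d)
    (Y : set 'cV[R]_d) :
  chabauty_dist (A n) Y @[n --> \oo] --> (0 : R) <-> local_cvg A Y.
Proof.
have d1 : 0 < d%:R + 1 :> R by rewrite ltr_wpDl.
split=> [/cvgrPdist_lt AY D e e0|AY].
  (* e' <= 1 makes the cut-off in the distance harmless, and the last bound
     makes the test ball contain the sup-norm ball of radius D. *)
  have [e' [e'0 e'1 e'e De']] : exists e' : R, [/\ 0 < e', e' <= 1,
      e' <= e & (d%:R + 1) * (`|D| + 1) <= 1 / e'].
    have D1 : 0 < (d%:R + 1) * (`|D| + 1) by rewrite mulr_gt0// ltr_wpDl.
    exists (Num.min (Num.min 1 e) (1 / ((d%:R + 1) * (`|D| + 1)))).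
    have h0 : 0 < Num.min (Num.min 1 e) (1 / ((d%:R + 1) * (`|D| + 1))).
      by rewrite !lt_min ltr01 e0/= divr_gt0.
    split=> //; rewrite ?ge_min ?lexx ?orbT//.
    by rewrite ler_pdivlMr// mulrC -ler_pdivlMr// ge_min lexx orbT.
  have := AY e' e'0; apply: filterS => n.
  rewrite sub0r normrN => /(le_lt_trans (ler_norm _)).
  move=> /(chabauty_dist_lt e'0 e'1)[AY1 AY2].
  have ball_D (x : 'cV[R]_d) : `|x| < D -> eucl_ball 0 (1 / e') x.
    move=> xD; rewrite /eucl_ball /= subr0; apply: lt_le_trans De'.
    apply: le_lt_trans (eucl_norm_le_normr _) _.
    have := ler_norm D; have := normr_ge0 x; have : 0 <= d%:R :> R by [].
    nra.
  have close (x y : 'cV[R]_d) : eucl_ball y e' x -> `|x - y| < e.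
    by move=> xy; apply: le_lt_trans (normr_le_eucl_norm _) (lt_le_trans xy _).
  split=> x.
    by move=> Ax /ball_D xD; have [|y Yy /close] := AY1 x; [split|exists y].
  move=> Yx /ball_D xD; have [|y Ay /close] := AY2 x; first by split.
  by exists y => //; rewrite distrC.
apply/cvgrPdist_le => e e0.
have := AY (1 / e) (e / (d%:R + 1)); rewrite divr_gt0// => /(_ isT).
apply: filterS => n [AY1 AY2].
suff /chabauty_dist_le-/(_ e0)/andP[? ?] : chabauty_close e (A n) Y.
  by rewrite sub0r normrN ger0_norm.
have ball_norm (x : 'cV[R]_d) : eucl_ball 0 (1 / e) x -> `|x| < 1 / e.
  by rewrite /eucl_ball /= subr0; apply: le_lt_trans (normr_le_eucl_norm _).
have close (x y : 'cV[R]_d) : `|x - y| < e / (d%:R + 1) -> eucl_ball y e x.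
  rewrite ltr_pdivlMr// /eucl_ball /= => xy.
  apply: le_lt_trans (eucl_norm_le_normr _) _; apply: le_lt_trans xy.
  by rewrite mulrC ler_wpM2l// lerDl.
split=> x [/ball_norm xe].
  by move=> /AY1-/(_ xe)[y Yy /close]; exists y.
by move=> /AY2-/(_ xe)[y Ay]; rewrite distrC => /close; exists y.
Qed.

(** In a bounded region only the finitely many parameters in s occur, and on
    a finite set pointwise convergence is uniform. The F n need not be
    injective, so it is enough that each value in the region be attained at
    some parameter of s. *)
Lemma range_local_cvg (R : realType) (d : nat) (I : choiceType)
    (F : nat -> I -> 'cV[R]_d) (L : I -> 'cV[R]_d) :
  (forall z, F n z @[n --> \oo] --> L z) ->
  (forall D : R, exists s : seq I,
    (forall z, `|L z| < D -> z \in s) /\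
    \forall n \near \oo, forall z, `|F n z| < D ->
      exists2 z', z' \in s & F n z = F n z') ->
  local_cvg (fun n => range (F n)) (range L).
Proof.
move=> FL proper D e e0; have [s [sL sF]] := proper D.
have closeF : \forall n \near \oo, forall z, z \in s -> `|F n z - L z| < e.
  elim: s {sL sF} => [|a s IH]; first by near=> n.
  have := FL a => /cvgrPdist_lt/(_ e e0) Fa.
  near=> n; move=> z; rewrite inE => /predU1P[->|zs].
    by rewrite distrC; near: n.
  by move: z zs; near: n.
near=> n; have Fn : forall z, z \in s -> `|F n z - L z| < e by near: n.
split=> [_ [z _ <-] zD|_ [z _ <-] /sL/Fn]; last first.
  by exists (F n z) => //; exists z.
have [z' z's ->] : exists2 z', z' \in s & F n z = F n z'.
  by move: z zD; near: n.
by exists (L z'); [exists z'|exact: Fn].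
Unshelve. all: by end_near. Qed.

(** * Polar coordinates around a distant point *)

Definition col2 (R : realType) (a b : R) : 'cV[R]_2 :=
  \col_(i < 2) if i == 0 then a else b.

Lemma cvg_cV (R : realType) (d : nat) (F : nat -> 'cV[R]_d) (L : 'cV[R]_d) :
  (forall i, F n i 0 @[n --> \oo] --> L i 0) -> F n @[n --> \oo] --> L.
Proof.
move=> FL; apply/cvgrPdist_lt => e e0.
have : \forall n \near \oo, forall i, `|L i 0 - F n i 0| < e.
  by apply: filter_forall => i; have /cvgrPdist_lt := FL i; exact.
apply: filterS => n LF.
rewrite [ltLHS]/Num.Def.normr /= mx_normrE; apply: bigmax_lt => // -[i j] _ /=.
by rewrite [j]ord1 !mxE.
Qed.

Lemma rotation_col2 (R : realType) (phi a b : R) : rotation_mx phi *m col2 a b =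
  col2 (cos phi * a - sin phi * b) (sin phi * a + cos phi * b).
Proof.
apply/colP => i; rewrite !mxE !big_ord_recl big_ord0 !mxE /= addr0.
by case: ifP => _; rewrite ?mulNr.
Qed.

Lemma polarB (R : realType) (rho psi r phi : R) :
  polar rho psi - polar r phi = rotation_mx phi *m
    col2 (rho * cos (psi - phi) - r) (rho * sin (psi - phi)).
Proof.
have [d ->] : exists d, psi = phi + d.
  by exists (psi - phi); rewrite [RHS]addrC subrK.
have -> : phi + d - phi = d by rewrite addrAC subrr add0r.
rewrite rotation_col2; apply/colP => i; rewrite !mxE.
by case: ifP => _; rewrite ?cosD ?sinD; ring.
Qed.

Lemma cvg_rotation_col2 (R : realType) (phi a b : nat -> R) (theta s t : R) :
  phi n @[n --> \oo] --> theta -> a n @[n --> \oo] --> s ->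
  b n @[n --> \oo] --> t ->
  rotation_mx (phi n) *m col2 (a n) (b n) @[n --> \oo] -->
  rotation_mx theta *m col2 s t.
Proof.
move=> phic ac bc.
have cosc : cos (phi n) @[n --> \oo] --> cos theta.
  by apply: continuous_cvg => //; exact: continuous_cos.
have sinc : sin (phi n) @[n --> \oo] --> sin theta.
  by apply: continuous_cvg => //; exact: continuous_sin.
apply: cvg_cV => i; rewrite rotation_col2 mxE.
under eq_cvg do rewrite rotation_col2 mxE.
by case: ifP => _; [apply: cvgB|apply: cvgD]; exact: cvgM.
Qed.

(** The mean value theorem, in a form that yields both the upper bound on the
    sine and, as cosine decreases on [0, pi], a lower bound. *)
Lemma sin_mean_value (R : realType) (x : R) :
  exists2 c, `|c| <= `|x| & sin x = x * cos c.
Proof.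
wlog x0 : x / 0 <= x => [hyp|].
  have [/hyp//|/ltW] := leP 0 x; rewrite -oppr_ge0 => /hyp[c cx sx].
  by exists c; [rewrite -[leRHS]normrN|rewrite -[LHS]opprK -sinN sx mulNr opprK].
have [|c] := @MVT_segment R sin cos _ _ x0 (fun y _ => is_derive_sin y).
  exact/continuous_subspaceT/continuous_sin.
rewrite in_itv /= => /andP[c0 cx]; rewrite sin0 !subr0 mulrC => sx.
by exists c => //; rewrite !ger0_norm.
Qed.

Lemma normr_sin_le (R : realType) (x : R) : `|sin x| <= `|x|.
Proof.
by have [c _ ->] := sin_mean_value x; rewrite normrM ler_piMr ?cos_max.
Qed.

Lemma one_sub_cos_le (R : realType) (x : R) : 1 - cos x <= x ^+ 2 / 2.
Proof.
have -> : x = (x / 2) *+ 2 by rewrite -mulr_natr divfK.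
rewrite cos_mulr2n cos2sin2; have := normr_sin_le (x / 2).
rewrite -ler_sqr ?nnegrE// !real_normK ?num_real//; lra.
Qed.

(** Write x = r^2 y with y = 1 + 2 h / r and h the first coordinate, so that
    sqrt x = r sqrt y and sqrt y tends to 1. Radially,
    sqrt x cos d - r = 2 h / (sqrt y + 1) - sqrt x (1 - cos d) where
    d = psi - phi = O(1 / r), so the last term is O(1 / r); tangentially,
    sqrt x sin d = sqrt y (r d) + o(1). *)
Lemma polar_chart_cvg (R : realType) (r x psi phi : nat -> R)
    (theta s t : R) :
  r n @[n --> \oo] --> +oo -> phi n @[n --> \oo] --> theta ->
  (x n - r n ^+ 2) / (2 * r n) @[n --> \oo] --> s ->
  r n * (psi n - phi n) @[n --> \oo] --> t ->
  polar (Num.sqrt (x n)) (psi n) - polar (r n) (phi n) @[n --> \oo] -->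
  rotation_mx theta *m col2 s t.
Proof.
move=> roo phic xc psic.
have r_gt0 : \forall n \near \oo, 0 < r n by exact: (cvgryPgt r).1.
have rV0 : (r n)^-1 @[n --> \oo] --> (0 : R) by apply/gtr0_cvgV0.
set h := fun n => (x n - r n ^+ 2) / (2 * r n) in xc.
set u := fun n => r n * (psi n - phi n) in psic.
pose y n := 1 + 2 * (h n * (r n)^-1); pose k n := Num.sqrt (y n).
have yc : y n @[n --> \oo] --> (1 : R).
  have := cvgD (cvg_cst (1 : R)) (cvgM (cvg_cst (2 : R)) (cvgM xc rV0)).
  by rewrite !mulr0 addr0; apply.
have kc : k n @[n --> \oo] --> (1 : R).
  by rewrite -[X in _ --> X]sqrtr1; apply: continuous_cvg => //; exact: sqrt_continuous.
have sqrt_x : \forall n \near \oo, Num.sqrt (x n) = r n * k n.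
  apply: filterS r_gt0 => n rn.
  have -> : x n = r n ^+ 2 * y n by rewrite /y /h; field; rewrite gt_eqF.
  by rewrite sqrtrM ?sqr_ge0// sqrtr_sqr gtr0_norm.
have dc : psi n - phi n @[n --> \oo] --> (0 : R).
  rewrite -(mulr0 t); apply: cvg_trans (cvgM psic rV0).
  apply: near_eq_cvg; apply: filterS r_gt0 => n rn.
  by rewrite /= /u mulrC mulKf// gt_eqF.
under eq_cvg do rewrite polarB.
apply: cvg_rotation_col2 => //.
  apply: (@cvg_trans _ ((2 * h n / (k n + 1) -
      (r n * k n) * (1 - cos (psi n - phi n))) @[n --> \oo])).
    apply: near_eq_cvg.
    have : \forall n \near \oo, 0 < y n by exact: (cvgr_gt _ yc).
    apply: filterS3 r_gt0 sqrt_x => n rn -> yn.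
    have kn : k n ^+ 2 = y n by rewrite sqr_sqrtr// ltW.
    have k0 : 0 <= k n by exact: sqrtr_ge0.
    have : 2 * h n / (k n + 1) = r n * (k n - 1).
      have -> : 2 * h n = r n * (k n ^+ 2 - 1).
        by rewrite kn /y; field; rewrite gt_eqF.
      by field; rewrite gt_eqF// ltr_wpDl.
    by move=> ->; ring.
  rewrite -(subr0 s); apply: cvgB.
    have -> : s = 2 * s / (1 + 1) by field.
    apply: cvgM; first by apply: cvgM => //; exact: cvg_cst.
    apply: cvgV; first by rewrite gt_eqF.
    by apply: cvgD => //; exact: cvg_cst.
  have b0 : k n * (u n * (psi n - phi n)) / 2 @[n --> \oo] --> (0 : R).
    have := cvgM (cvgM kc (cvgM psic dc)) (cvg_cst (2^-1 : R)).
    by rewrite !mulr0 mul0r; apply.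
  apply: squeeze_cvgr (cvg_cst 0) b0; apply: filterS r_gt0 => n rn.
  have k0 : 0 <= k n by exact: sqrtr_ge0.
  have c1 := cos_le1 (psi n - phi n); have c2 := one_sub_cos_le (psi n - phi n).
  have rk : 0 <= r n * k n by rewrite mulr_ge0// ltW.
  apply/andP; split; first by rewrite mulr_ge0// subr_ge0.
  apply: le_trans (ler_wpM2l rk c2) _.
  by rewrite le_eqVlt; apply/orP; left; apply/eqP; rewrite /u; ring.
apply: (@cvg_trans _ ((k n * (r n * sin (psi n - phi n))) @[n --> \oo])).
  by apply: near_eq_cvg; apply: filterS sqrt_x => n ->; rewrite mulrCA mulrA.
rewrite -[t]mul1r; apply: cvgM => //.
have e0 : `|u n| * ((psi n - phi n) ^+ 2 / 2) @[n --> \oo] --> (0 : R).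
  have := cvgM (cvg_norm psic) (cvgM (cvgM dc dc) (cvg_cst (2^-1 : R))).
  by rewrite !mulr0 mul0r mulr0; apply.
suff diff0 : r n * sin (psi n - phi n) - u n @[n --> \oo] --> (0 : R).
  rewrite -[t]add0r; apply: cvg_trans (cvgD diff0 psic).
  by apply: near_eq_cvg; apply: nearW => n; rewrite /= subrK.
apply/norm_cvg0P; apply: squeeze_cvgr (cvg_cst 0) e0; apply: nearW => n.
rewrite normr_ge0 /=; have [c cd ->] := sin_mean_value (psi n - phi n).
have -> : r n * ((psi n - phi n) * cos c) - u n = - (u n * (1 - cos c)).
  by rewrite /u; ring.
rewrite normrN normrM ler_wpM2l// ger0_norm ?subr_ge0 ?cos_le1//.
apply: le_trans (one_sub_cos_le c) _; rewrite ler_pM2r//.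
by rewrite -[leLHS]real_normK ?num_real// -[leRHS]real_normK ?num_real// ler_sqr ?nnegrE.
Qed.

Lemma cos_sinD2piz (R : realType) (x : R) (k : int) :
  cos (x + 2 * pi * k%:~R) = cos x /\ sin (x + 2 * pi * k%:~R) = sin x.
Proof.
have nat_case y (n : nat) : cos (y + 2 * pi * n%:R) = cos y /\
    sin (y + 2 * pi * n%:R) = sin y :> R.
  have -> : 2 * pi * n%:R = pi *+ 2 *+ n :> R by rewrite mulr_natl mulr_natr.
  by rewrite (periodicn (@cosD2pi R)) (periodicn (@sinD2pi R)).
case: (intP k) => [|n|n]; [exact: (nat_case _ 0%N)|exact: nat_case|].
have := nat_case (x + 2 * pi * (- n.+1%:Z)%:~R) n.+1.
by rewrite mulrNz mulrN subrK => -[-> ->].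
Qed.

Lemma polarD2piz (R : realType) (r x : R) (k : int) :
  polar r (x + 2 * pi * k%:~R) = polar r x.
Proof. by rewrite /polar; have [-> ->] := cos_sinD2piz x k. Qed.

Lemma angle_mod_2pi (R : realType) (x : R) :
  exists k : int, `|x + 2 * pi * k%:~R| <= pi.
Proof.
have p0 : 0 < 2 * pi :> R by rewrite mulr_gt0// pi_gt0.
exists (- Num.floor ((x + pi) / (2 * pi))).
have /andP[] := floor_itv ((x + pi) / (2 * pi)).
rewrite ler_pdivlMr// ltr_pdivrMr// intrD1 mulrNz.
by set f := (Num.floor _)%:~R => h1 h2; rewrite ler_norml; apply/andP; split; nra.
Qed.

(** The intermediate point c of the mean value theorem lies closer to 0 than
    x, so cos c >= cos x >= 1/2. *)
Lemma normr_le_2sin (R : realType) (x : R) :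
  `|x| <= pi -> 2^-1 <= cos x -> `|x| <= 2 * `|sin x|.
Proof.
move=> xpi cx; have [c cx' ->] := sin_mean_value x.
suff : cos x <= cos c.
  have := normr_ge0 x; rewrite normrM => x0 /(le_trans cx) c2.
  by rewrite [`|cos c|]ger0_norm; nra.
rewrite -cos_norm -[cos c]cos_norm leNgt.
rewrite ltr_cos ?in_itv/= ?normr_ge0 ?xpi ?(le_trans cx')//.
by rewrite -leNgt.
Qed.

(** Each coordinate of a rotated vector is a combination of the two original
    ones with coefficients at most 1, whence the factor 2 in the sup norm. *)
Lemma rotation_col2_bound (R : realType) (D phi a b : R) :
  `|rotation_mx phi *m col2 a b| < D -> `|a| <= 2 * D /\ `|b| <= 2 * D.
Proof.
set v := _ *m _ => vD.
have v0 := le_lt_trans (coord_le_normr v 0) vD.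
have v1 := le_lt_trans (coord_le_normr v 1) vD.
have := cos_max phi; have := sin_max phi; have := cos2Dsin2 phi.
move: v0 v1; rewrite /v rotation_col2 !mxE /=.
move: (cos phi) (sin phi) => c s v0 v1 cs s1 c1.
have aE : a = c * (c * a - s * b) + s * (s * a + c * b).
  by rewrite -[LHS]mul1r -cs; ring.
have bE : b = c * (s * a + c * b) - s * (c * a - s * b).
  by rewrite -[LHS]mul1r -cs; ring.
move: (c * a - s * b) (s * a + c * b) v0 v1 aE bE => x y xD yD -> ->.
have bd u w : `|u| <= 1 -> `|w| < D -> `|u * w| <= D.
  by move=> u1 /ltW wD; rewrite normrM -[D]mul1r ler_pM.
have := bd _ _ c1 xD; have := bd _ _ s1 yD; have := bd _ _ c1 yD.
have := bd _ _ s1 xD => h1 h2 h3 h4; split.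
  by apply: le_trans (ler_normD _ _) _; lra.
by apply: le_trans (ler_normB _ _) _; lra.
Qed.

(** The converse of polar_chart_cvg for boundedness. A point near r e^(i phi)
    makes a small angle d with it modulo 2 pi, because its projection on the
    direction phi is at least r - 2 D; as cos d >= 1/2, the arc r |d| is
    comparable to the distance rho |sin d| to the axis. *)
Lemma polar_chart_proper (R : realType) (D r x psi phi : R) :
  0 < D -> 8 * D <= r -> 0 <= x ->
  `|polar (Num.sqrt x) psi - polar r phi| < D ->
  exists k : int, `|(x - r ^+ 2) / (2 * r)| <= 8 * D /\
    `|r * (psi + 2 * pi * k%:~R - phi)| <= 8 * D.
Proof.
move=> D0 rD x0; have [k dk] := angle_mod_2pi (psi - phi).
rewrite -(polarD2piz _ psi k).
have dE : psi - phi + 2 * pi * k%:~R = psi + 2 * pi * k%:~R - phi by ring.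
rewrite {}dE in dk.
move=> pD; exists k.
move: (psi + 2 * pi * k%:~R) dk pD => {}psi dk pD.
set rho := Num.sqrt x in pD.
have rho0 : 0 <= rho by exact: sqrtr_ge0.
have xE : x = rho ^+ 2 by rewrite sqr_sqrtr.
have r0 : 0 < r by nra.
set d := psi - phi in dk *.
have [aD bD] : `|rho * cos d - r| <= 2 * D /\ `|rho * sin d| <= 2 * D.
  by apply: (@rotation_col2_bound _ _ phi); rewrite -polarB.
have cd := cos_max d; have c1 := cos_le1 d.
have rhoD : `|rho - r| <= 4 * D.
  move: aD bD; rewrite !ler_norml => /andP[a1 a2] /andP[b1 b2].
  have := cos2Dsin2 d; move: (cos d) (sin d) c1 a1 a2 b1 b2 => c s c1 a1 a2 b1 b2 cs.
  have rc : rho * c <= rho by rewrite ler_piMr.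
  apply/andP; split; first lra.
  rewrite lerBlDr; have : rho ^+ 2 <= (r + 4 * D) ^+ 2.
    have -> : rho ^+ 2 = (rho * c) ^+ 2 + (rho * s) ^+ 2.
      by rewrite !exprMn -mulrDr cs mulr1.
    have h1 : (rho * c) ^+ 2 <= (r + 2 * D) ^+ 2 by rewrite ler_sqr ?nnegrE; lra.
    have h2 : (rho * s) ^+ 2 <= (2 * D) ^+ 2.
      rewrite -[leLHS]real_normK ?num_real// ler_sqr ?nnegrE ?mulr_ge0 ?(ltW D0)//.
      by rewrite ler_norml; apply/andP; split.
    by have := mulr_gt0 r0 D0; have := sqr_ge0 D; nra.
  rewrite ler_sqr ?nnegrE//; lra.
move: (rhoD); rewrite ler_norml => /andP[rho1 rho2]; split.
  rewrite normrM [`|_^-1|]gtr0_norm ?invr_gt0 ?mulr_gt0// ler_pdivrMr ?mulr_gt0//.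
  have -> : x - r ^+ 2 = (rho - r) * (rho + r) by rewrite xE; ring.
  by rewrite normrM [`|rho + r|]ger0_norm; nra.
have cd2 : 2^-1 <= cos d.
  by move: aD; rewrite ler_norml => /andP[a1 _]; nra.
have := normr_le_2sin dk cd2.
move: bD; rewrite normrM (ger0_norm rho0) => bD ds.
by rewrite normrM gtr0_norm//; have := normr_ge0 d; have := normr_ge0 (sin d); nra.
Qed.

(** The angle is the arc cosine of x / r, negated in the lower half-plane. *)
Lemma polar_surj (R : realType) (v : 'cV[R]_2) :
  exists2 phi : R, `|phi| <= pi & v = polar (eucl_norm v) phi.
Proof.
have nE : eucl_norm v = Num.sqrt (v 0 0 ^+ 2 + v 1 0 ^+ 2).
  rewrite /eucl_norm big_ord_recl big_ord1; congr (Num.sqrt (_ + v _ _ ^+ 2)).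
  exact/val_inj.
have coord phi : v 0 0 = eucl_norm v * cos phi ->
    v 1 0 = eucl_norm v * sin phi -> v = polar (eucl_norm v) phi.
  move=> v0 v1; apply/colP => i; rewrite mxE; case: (unliftP 0 i) => [j|] ->.
    by rewrite [j]ord1 /= -v1; congr (v _ _); exact/val_inj.
  by rewrite eqxx.
set x := v 0 0 in nE coord *; set y := v 1 0 in nE coord *.
set r := eucl_norm v in nE coord *.
have r0 : 0 <= r by exact: sqrtr_ge0.
have rE : r ^+ 2 = x ^+ 2 + y ^+ 2 by rewrite nE sqr_sqrtr// addr_ge0// sqr_ge0.
have [r00|rn0] := eqVneq r 0.
  exists 0; first by rewrite normr0 pi_ge0.
  by apply: coord; rewrite r00 mul0r; nra.
have rp : 0 < r by rewrite lt_neqAle eq_sym rn0.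
have xr : -1 <= x / r <= 1.
  by rewrite ler_pdivlMr// ler_pdivrMr//; apply/andP; split; nra.
have cosE : cos (acos (x / r)) = x / r by rewrite acosK// in_itv.
have sinE : r * sin (acos (x / r)) = `|y|.
  have {1}-> : r = Num.sqrt (r ^+ 2) by rewrite sqrtr_sqr ger0_norm.
  rewrite sin_acos// -sqrtrM ?sqr_ge0// -sqrtr_sqr; congr Num.sqrt.
  have -> : r ^+ 2 * (1 - (x / r) ^+ 2) = r ^+ 2 - x ^+ 2 by field.
  by rewrite rE addrAC subrr add0r.
have acos_bd : `|acos (x / r)| <= pi.
  by rewrite ger0_norm ?acos_ge0// acos_lepi.
have [y0|y0] := leP 0 y.
  exists (acos (x / r)) => //; apply: coord; first by rewrite cosE mulrC divfK.
  by rewrite sinE ger0_norm.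
exists (- acos (x / r)); first by rewrite normrN.
apply: coord; first by rewrite cosN cosE mulrC divfK.
by rewrite sinN mulrN sinE ltr0_norm// opprK.
Qed.

(** The n-th point is at distance sqrt n from the origin, so bounded regions
    contain finitely many points. *)
Lemma fermat_spiral_closed (R : realType) (alpha : R) :
  closed (fermat_spiral alpha).
Proof.
apply: locally_finite_closed => D.
exists [seq polar (Num.sqrt n%:R) (2 * pi * alpha * n%:R)
  | n <- iota 0 (Num.truncn (4 * D ^+ 2)).+1].
move=> _ [n _ <-] nD; apply/mapP; exists n => //; rewrite mem_iota /= add0n.
rewrite ltnS.
set v := polar _ _ in nD.
have D0 : 0 <= D by rewrite (le_trans _ (ltW nD)).
have bound i : v i 0 ^+ 2 <= D ^+ 2.
  rewrite -[leLHS]real_normK ?num_real// ler_sqr ?nnegrE//.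
  exact: le_trans (coord_le_normr _ _) (ltW nD).
rewrite truncn_ge_nat ?mulr_ge0 ?sqr_ge0//.
have := bound 0; have := bound 1; rewrite !mxE /=.
set a := 2 * pi * alpha * n%:R => b1 b0.
have -> : n%:R = (Num.sqrt n%:R * cos a) ^+ 2 + (Num.sqrt n%:R * sin a) ^+ 2 :> R.
  by rewrite !exprMn -mulrDr cos2Dsin2 mulr1 sqr_sqrtr.
by have := sqr_ge0 D; lra.
Qed.

(** * The spiral seen from a distant point *)

(** Cramer's rule, the determinant of the two convergents being 1 or - 1. *)
Lemma cvgt_basis_surj (R : realType) (alpha : R) (j : nat) (m k : int) :
  exists z : 'cV[int]_2,
    z 0 0 * cvgt_den alpha j + z 1 0 * cvgt_den alpha j.+1 = m /\
    z 0 0 * cvgt_num alpha j + z 1 0 * cvgt_num alpha j.+1 = k.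
Proof.
have det := cvgt_det alpha j.
set q := cvgt_den _ j in det *; set q' := cvgt_den _ j.+1 in det *.
set p := cvgt_num _ j in det *; set p' := cvgt_num _ j.+1 in det *.
set e := (-1) ^+ j in det.
have ee : e * e = 1 by rewrite -expr2 sqrr_sign.
exists (\col_i if i == 0 then e * (p' * m - q' * k) else e * (q * k - p * m)).
have one : e * (q * p' - q' * p) = 1 by rewrite det.
rewrite !mxE /=; split.
  by transitivity (e * (q * p' - q' * p) * m); [ring|rewrite one mul1r].
by transitivity (e * (q * p' - q' * p) * k); [ring|rewrite one mul1r].
Qed.

Lemma int_box_finite (R : realType) (C : R) : exists s : seq 'cV[int]_2,
  forall z : 'cV[int]_2, `|(z 0 0)%:~R| <= C -> `|(z 1 0)%:~R| <= C -> z \in s.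
Proof.
pose N := Num.truncn C.
pose f (i : 'I_(N.*2.+1)) : int := (i : nat)%:Z - N%:Z.
exists [seq map_mx f x | x <- enum {: 'cV['I_(N.*2.+1)]_2}] => z z0 z1.
apply/mapP; exists (map_mx (fun a : int => inord (absz (a + N%:Z))) z).
  by rewrite mem_enum.
apply/colP => i; rewrite !mxE /f.
have : `|(z i 0)%:~R| <= C :> R.
  case: (unliftP 0 i) => [k|] -> //.
  by rewrite [k]ord1 (_ : lift 0 0 = 1)//; exact/val_inj.
move: (z i 0) => {z z0 z1 i} a aC.
have C0 : 0 <= C by rewrite (le_trans _ aC).
have aN : (`|a| <= N)%N.
  by rewrite truncn_ge_nat// natr_absz intr_norm.
rewrite inordK; lia.
Qed.

Lemma cvg_near_bounded (R : realType) (u : nat -> R) (l : R) :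
  u n @[n --> \oo] --> l -> \forall n \near \oo, `|u n| <= `|l| + 1.
Proof.
move=> ul; apply: (cvgr_norm_le _ ul).
by rewrite ltrDl.
Qed.

(** Cramer's rule: the inverse of a matrix with bounded entries and
    determinant at least 1 in absolute value is bounded. *)
Lemma large_det_bound (R : realType) (a b c d x y K C delta : R) :
  1 <= delta -> `|a * d - b * c| = delta ->
  `|a| <= K -> `|b| <= K -> `|c| <= K -> `|d| <= K ->
  `|a * x + b * y| <= C -> `|c * x + d * y| <= C ->
  `|x| <= 2 * K * C /\ `|y| <= 2 * K * C.
Proof.
move=> d1 dE aK bK cK dK.
set u := a * x + b * y; set v := c * x + d * y => uC vC.
have xE : (a * d - b * c) * x = d * u - b * v by rewrite /u /v; ring.
have yE : (a * d - b * c) * y = a * v - c * u by rewrite /u /v; ring.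
have bd e f w w' : `|e| <= K -> `|f| <= K -> `|w| <= C -> `|w'| <= C ->
    `|e * w - f * w'| <= 2 * K * C.
  move=> eK fK wC wC'; apply: le_trans (ler_normB _ _) _.
  have -> : 2 * K * C = K * C + K * C by ring.
  by rewrite !normrM lerD// ler_pM.
have le1 z : `|z| <= `|(a * d - b * c) * z|.
  by rewrite normrM dE ler_peMl.
by split; apply: le_trans (le1 _) _; rewrite ?xE ?yE; exact: bd.
Qed.

(** Round the real solution of the linear system to integers. *)
Lemma lattice_rounding (R : realType) (a b c d x y : R) :
  a * d - b * c != 0 -> exists z : 'cV[int]_2,
    `|x + a * (z 0 0)%:~R + b * (z 1 0)%:~R| <= `|a| + `|b| /\
    `|y + c * (z 0 0)%:~R + d * (z 1 0)%:~R| <= `|c| + `|d|.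
Proof.
set D := a * d - b * c => D0.
pose u := (b * y - d * x) / D; pose v := (c * x - a * y) / D.
have frac (s : R) : `|(Num.floor s)%:~R - s| <= 1.
  have /andP[] := floor_itv s; rewrite intrD1.
  by move=> *; rewrite ler_norml; apply/andP; split; lra.
have lin e f : `|e * ((Num.floor u)%:~R - u) + f * ((Num.floor v)%:~R - v)| <=
    `|e| + `|f|.
  by apply: le_trans (ler_normD _ _) _; rewrite !normrM lerD// ler_piMr.
exists (\col_i if i == 0 then Num.floor u else Num.floor v); rewrite !mxE /=.
split.
  rewrite (_ : x + _ + _ =
    a * ((Num.floor u)%:~R - u) + b * ((Num.floor v)%:~R - v)) ?lin//.
  by rewrite /u /v /D; field.
rewrite (_ : y + _ + _ =
  c * ((Num.floor u)%:~R - u) + d * ((Num.floor v)%:~R - v)) ?lin//.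
by rewrite /u /v /D; field.
Qed.

(** The integer k only turns the angle by a multiple of 2 pi, but makes the
    points near u a function on Z^2. For m < 0 the square root is 0 and the
    value is the origin, the point of the spiral with n = 0, so that the
    parametrisation is defined on all of Z^2. *)
Definition spiral_pt (R : realType) (alpha : R) (m k : int) : 'cV[R]_2 :=
  polar (Num.sqrt m%:~R) (2 * pi * (alpha * m%:~R - k%:~R)).

Lemma spiral_ptP (R : realType) (alpha : R) (x : 'cV[R]_2) :
  fermat_spiral alpha x <-> exists m k, x = spiral_pt alpha m k.
Proof.
have natE (n : nat) k : spiral_pt alpha n k =
    polar (Num.sqrt n%:R) (2 * pi * alpha * n%:R).
  rewrite /spiral_pt; set a := 2 * _ * (_ - _).
  rewrite -(polarD2piz _ a k); congr polar; rewrite /a; ring.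
split=> [[n _ <-]|[[n|n] [k ->]]]; first by exists n, 0; rewrite natE.
  by rewrite natE; exists n.
exists 0%N => //; rewrite sqrtr0 /spiral_pt ler0_sqrtr; last first.
  by rewrite lerz0.
by apply/colP => i; rewrite !mxE !mul0r.
Qed.

Lemma spiral_lattice_range (R : realType) (theta t beta c c' e1 e2 : R) :
  translate (rotation_mx theta *m col2 e1 e2) (spiral_lattice theta t beta c c')
  = range (fun z : 'cV[int]_2 => rotation_mx theta *m col2
      (e1 + Num.sqrt pi * t * (z 0 0)%:~R + Num.sqrt pi * (t * beta) * (z 1 0)%:~R)
      (e2 + Num.sqrt pi * (c / t) * (z 0 0)%:~R
          + Num.sqrt pi * (c' / beta / t) * (z 1 0)%:~R)).
Proof.
rewrite /translate /spiral_lattice /lattice_of image_comp.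
congr image; apply/funext => z /=.
rewrite -scalemxAl -!mulmxA scalemxAr -mulmxDr; congr (_ *m _).
apply/colP => i; rewrite !(mxE, big_ord_recl, big_ord0) /=.
have -> : z (lift 0 0) 0 = z 1 0 by congr (z _ _); exact/val_inj.
by case: ifP => _; ring.
Qed.

(** The images of (q_j, p_j) and (q_{j+1}, p_{j+1}) under the linear part
    (m, k) |-> (m / (2 r), 2 pi r (alpha m - k)) of the chart are the columns
    of the matrix sqrt pi A_t M_j of the theorem. *)
Lemma chart_matrixE (R : realType) (alpha r : R) (j : nat) :
  irrational alpha -> 0 < r ->
  let q : R := (cvgt_den alpha j)%:~R in
  let q' : R := (cvgt_den alpha j.+1)%:~R in
  let tau := cvgt_triple alpha j in
  let t := q / (2 * r * Num.sqrt pi) in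
  [/\ q / (2 * r) = Num.sqrt pi * t,
      q' / (2 * r) = Num.sqrt pi * (t * tau.1.1),
      2 * pi * r * cvgt_err alpha j = Num.sqrt pi * (tau.1.2 / t) &
      2 * pi * r * cvgt_err alpha j.+1 =
        Num.sqrt pi * (tau.2 / tau.1.1 / t)].
Proof.
move=> airr r0.
have q0 : 0 < (cvgt_den alpha j)%:~R :> R.
  exact: lt_le_trans ltr01 (cvgt_den_ge1 j airr).
have q'0 : 0 < (cvgt_den alpha j.+1)%:~R :> R.
  exact: lt_le_trans ltr01 (cvgt_den_ge1 j.+1 airr).
rewrite /cvgt_triple -/(cvgt_err alpha j) -/(cvgt_err alpha j.+1).
cbv zeta; rewrite [X in [/\ _, _ = X, _ & _]]/= [X in [/\ _, _, _ = X & _]]/=.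
rewrite [X in [/\ _, _, _ & _ = X]]/=.
have : 0 < Num.sqrt pi :> R by rewrite sqrtr_gt0 pi_gt0.
have : Num.sqrt pi ^+ 2 = pi :> R by rewrite sqr_sqrtr// pi_ge0.
move: (Num.sqrt pi) (cvgt_den alpha j)%:~R (cvgt_den alpha j.+1)%:~R q0 q'0.
move=> s q q' q0 q'0 <- s0.
by split; field; rewrite !gt_eqF.
Qed.

(** The density of the spiral: its discs of radius r contain about r^2 points,
    so the limiting lattices have covolume pi. *)
Lemma chart_det (R : realType) (alpha r : R) (j : nat) : r != 0 ->
  `|(cvgt_den alpha j)%:~R / (2 * r) * (2 * pi * r * cvgt_err alpha j.+1) -
    (cvgt_den alpha j.+1)%:~R / (2 * r) * (2 * pi * r * cvgt_err alpha j)| = pi.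
Proof.
move=> rn0; have := congr1 Num.norm (cvgt_err_det alpha j).
rewrite normrN normrX normrN1 expr1n => det1.
rewrite -[RHS](gtr0_norm (pi_gt0 R)) -[RHS]mulr1 -[X in _ = _ * X]det1 -normrM.
by congr `|_|; field.
Qed.

(** Coordinates z on Z^2 are taken in the basis of the two convergents, from
    the origin (m0 n, k0 n). In them the charts have convergent coefficients
    and a determinant of absolute value pi, which passes to the limit: hence
    the limit map is proper, its image is closed, and the charts are proper
    uniformly in n. *)
Lemma spiral_patch_cvg (R : realType) (alpha : R) (r phi : nat -> R)
    (j : nat -> nat) (m0 k0 : nat -> int) (beta c c' t theta e1 e2 : R) :
  irrational alpha ->
  r n @[n --> \oo] --> +oo -> phi n @[n --> \oo] --> theta ->
  (cvgt_triple alpha (j n)).1.1 @[n --> \oo] --> beta ->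
  (cvgt_triple alpha (j n)).1.2 @[n --> \oo] --> c ->
  (cvgt_triple alpha (j n)).2 @[n --> \oo] --> c' ->
  (cvgt_den alpha (j n))%:~R / (2 * r n * Num.sqrt pi) @[n --> \oo] --> t ->
  0 < t ->
  ((m0 n)%:~R - r n ^+ 2) / (2 * r n) @[n --> \oo] --> e1 ->
  r n * (2 * pi * (alpha * (m0 n)%:~R - (k0 n)%:~R) - phi n) @[n --> \oo] --> e2 ->
  let Y := translate (rotation_mx theta *m col2 e1 e2)
    (spiral_lattice theta t beta c c') in
  closed Y /\
  local_cvg (fun n => translate (- polar (r n) (phi n)) (fermat_spiral alpha)) Y.
Proof.
move=> airr roo phic betac cc cc' tc t0 e1c e2c /=.
have pi0 : 0 < pi :> R := pi_gt0 R.
set sp := Num.sqrt pi in tc *.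
pose q n : R := (cvgt_den alpha (j n))%:~R.
pose q' n : R := (cvgt_den alpha (j n).+1)%:~R.
pose d n := cvgt_err alpha (j n); pose d' n := cvgt_err alpha (j n).+1.
have q_gt0 n : 0 < q n.
  have /andP[q1 _] := cvgt_den_nondecreasing (j n) airr.
  by rewrite /q ltr0z (lt_le_trans _ q1).
have r_gt0 : \forall n \near \oo, 0 < r n by exact: (cvgryPgt r).1.
have beta1 : 1 <= beta.
  have /cvg_lim <- // := betac.
  apply: limr_ge; first exact: cvgP betac.
  apply: nearW => n; have /andP[_ qq] := cvgt_den_nondecreasing (j n) airr.
  by rewrite /= -/(q n) -/(q' n) ler_pdivlMr// mul1r /q /q' ler_int.
have beta0 : beta != 0 by rewrite gt_eqF// (lt_le_trans ltr01).
have tn0 : t != 0 by rewrite gt_eqF.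
pose h11 n := q n / (2 * r n); pose h12 n := q' n / (2 * r n).
pose h21 n := 2 * pi * r n * d n; pose h22 n := 2 * pi * r n * d' n.
pose g11 := sp * t; pose g12 := sp * (t * beta).
pose g21 := sp * (c / t); pose g22 := sp * (c' / beta / t).
have chartE n (rn : 0 < r n) := chart_matrixE (j n) airr rn.
have h11c : h11 n @[n --> \oo] --> g11.
  apply: cvg_trans (cvgM (cvg_cst sp) tc); apply: near_eq_cvg.
  by apply: filterS r_gt0 => n /chartE[].
have h12c : h12 n @[n --> \oo] --> g12.
  apply: cvg_trans (cvgM (cvg_cst sp) (cvgM tc betac)); apply: near_eq_cvg.
  by apply: filterS r_gt0 => n /chartE[].
have h21c : h21 n @[n --> \oo] --> g21.
  apply: cvg_trans (cvgM (cvg_cst sp) (cvgM cc (cvgV tn0 tc))).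
  by apply: near_eq_cvg; apply: filterS r_gt0 => n /chartE[].
have h22c : h22 n @[n --> \oo] --> g22.
  apply: cvg_trans (cvgM (cvg_cst sp)
    (cvgM (cvgM cc' (cvgV beta0 betac)) (cvgV tn0 tc))).
  by apply: near_eq_cvg; apply: filterS r_gt0 => n /chartE[].
have hdet n : 0 < r n -> `|h11 n * h22 n - h12 n * h21 n| = pi.
  by move=> rn; rewrite chart_det// gt_eqF.
have gdet : `|g11 * g22 - g12 * g21| = pi.
  have detc : `|h11 n * h22 n - h12 n * h21 n| @[n --> \oo] -->
      `|g11 * g22 - g12 * g21|.
    by apply: cvg_norm; apply: cvgB; exact: cvgM.
  have : `|h11 n * h22 n - h12 n * h21 n| @[n --> \oo] --> pi.
    apply: (@cvg_trans _ ((fun=> pi : R) @ \oo)); last exact: cvg_cst.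
    by apply: near_eq_cvg; apply: filterS r_gt0 => n /hdet.
  by move=> pic; apply: (@cvg_unique _ (@Rhausdorff R) _ _ _ _ detc pic).
rewrite spiral_lattice_range -/sp -/g11 -/g12 -/g21 -/g22.
pose L (z : 'cV[int]_2) := rotation_mx theta *m col2
  (e1 + g11 * (z 0 0)%:~R + g12 * (z 1 0)%:~R)
  (e2 + g21 * (z 0 0)%:~R + g22 * (z 1 0)%:~R).
rewrite -/L.
have pi1 : 1 <= pi :> R by have := pi_ge2 R; lra.
have L_proper D : exists s : seq 'cV[int]_2,
    forall z, `|L z| < D -> z \in s.
  pose C := 2 * D + `|e1| + `|e2|.
  pose K := `|g11| + `|g12| + `|g21| + `|g22|.
  have [s sP] := int_box_finite (2 * K * C).
  exists s => z /rotation_col2_bound[z1 z2].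
  have [] : `|(z 0 0)%:~R : R| <= 2 * K * C /\ `|(z 1 0)%:~R : R| <= 2 * K * C.
    have := normr_ge0 g11; have := normr_ge0 g12.
    have := normr_ge0 g21; have := normr_ge0 g22 => *.
    apply: (large_det_bound pi1 gdet); rewrite /K; try lra.
      have -> : g11 * (z 0 0)%:~R + g12 * (z 1 0)%:~R =
        (e1 + g11 * (z 0 0)%:~R + g12 * (z 1 0)%:~R) - e1 by ring.
      by apply: le_trans (ler_normB _ _) _; have := normr_ge0 e2; rewrite /C; lra.
    have -> : g21 * (z 0 0)%:~R + g22 * (z 1 0)%:~R =
      (e2 + g21 * (z 0 0)%:~R + g22 * (z 1 0)%:~R) - e2 by ring.
    by apply: le_trans (ler_normB _ _) _; have := normr_ge0 e1; rewrite /C; lra.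
  exact: sP.
split.
  apply: locally_finite_closed => D; have [s sP] := L_proper D.
  exists [seq L z | z <- s] => _ [z _ <-] /sP zs; exact: map_f.
pose mz n (z : 'cV[int]_2) : int := m0 n +
  (z 0 0 * cvgt_den alpha (j n) + z 1 0 * cvgt_den alpha (j n).+1).
pose kz n (z : 'cV[int]_2) : int := k0 n +
  (z 0 0 * cvgt_num alpha (j n) + z 1 0 * cvgt_num alpha (j n).+1).
have mk_surj n m k : exists z, mz n z = m /\ kz n z = k.
  have [z [zm zk]] := cvgt_basis_surj alpha (j n) (m - m0 n) (k - k0 n).
  by exists z; rewrite /mz /kz zm zk !(addrC _ (_ - _)) !subrK.
pose E1 n := ((m0 n)%:~R - r n ^+ 2) / (2 * r n).
pose E2 n := r n * (2 * pi * (alpha * (m0 n)%:~R - (k0 n)%:~R) - phi n).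
have chart1 n z : ((mz n z)%:~R - r n ^+ 2) / (2 * r n) =
    E1 n + h11 n * (z 0 0)%:~R + h12 n * (z 1 0)%:~R.
  by rewrite /mz !intrD !intrM /E1 /h11 /h12 /q /q'; ring.
have chart2 n z : r n * (2 * pi * (alpha * (mz n z)%:~R - (kz n z)%:~R) - phi n) =
    E2 n + h21 n * (z 0 0)%:~R + h22 n * (z 1 0)%:~R.
  rewrite /mz /kz !intrD !intrM /E2 /h21 /h22 /d /d' /cvgt_err; ring.
pose F n (z : 'cV[int]_2) : 'cV[R]_2 :=
  spiral_pt alpha (mz n z) (kz n z) - polar (r n) (phi n).
have rangeF n :
    translate (- polar (r n) (phi n)) (fermat_spiral alpha) = range (F n).
  apply/seteqP; split=> [_ [x /spiral_ptP[m [k ->]] <-]|_ [z _ <-]].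
    by have [z [<- <-]] := mk_surj n m k; exists z => //; rewrite addrC.
  exists (spiral_pt alpha (mz n z) (kz n z)); last by rewrite addrC.
  by apply/spiral_ptP; exists (mz n z), (kz n z).
rewrite (funext rangeF); apply: range_local_cvg => [z|D].
  apply: (polar_chart_cvg roo phic).
    under eq_cvg do rewrite chart1.
    apply: cvgD; [apply: cvgD => //|]; apply: cvgM => //; exact: cvg_cst.
  under eq_cvg do rewrite chart2.
  apply: cvgD; [apply: cvgD => //|]; apply: cvgM => //; exact: cvg_cst.
have [s sP] := L_proper D.
pose D1 := `|D| + 1; have D10 : 0 < D1 by rewrite ltr_wpDl.
have DD1 : D < D1 by rewrite (le_lt_trans (ler_norm _))// ltrDl.
(* The entries and offsets of the n-th chart are eventually within 1 of their
   limits. *)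
pose C := 8 * D1 + (`|e1| + 1) + (`|e2| + 1).
pose K := (`|g11| + 1) + (`|g12| + 1) + (`|g21| + 1) + (`|g22| + 1).
have [s' s'P] := int_box_finite (2 * K * C).
exists (s ++ s'); split=> [z /sP zs|]; first by rewrite mem_cat zs.
have r_large : \forall n \near \oo, 8 * D1 <= r n by exact: (cvgryPge r).1.
have K11 := cvg_near_bounded h11c; have K12 := cvg_near_bounded h12c.
have K21 := cvg_near_bounded h21c; have K22 := cvg_near_bounded h22c.
have KE1 := cvg_near_bounded e1c; have KE2 := cvg_near_bounded e2c.
near=> n; move=> z Fz.
have [N _ NE] : fermat_spiral alpha (spiral_pt alpha (mz n z) (kz n z)).
  by apply/spiral_ptP; exists (mz n z), (kz n z).
have rn : 8 * D1 <= r n by near: n.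
have [k [x1 x2]] : exists k : int,
    `|(N%:R - r n ^+ 2) / (2 * r n)| <= 8 * D1 /\
    `|r n * (2 * pi * alpha * N%:R + 2 * pi * k%:~R - phi n)| <= 8 * D1.
  apply: polar_chart_proper => //.
  by rewrite NE; exact: lt_trans Fz DD1.
(* The parameter z itself need not be bounded: only its reduction z', for which
   the angle is the one closest to phi n, is confined to the box s'. *)
have [z' [zm zk]] := mk_surj n N (- k).
have sumE : 2 * pi * alpha * N%:R + 2 * pi * k%:~R =
    2 * pi * (alpha * (mz n z')%:~R - (kz n z')%:~R).
  by rewrite zm zk mulrNz; ring.
exists z'; last first.
  by rewrite /F -NE /spiral_pt -sumE zm polarD2piz.
rewrite mem_cat; apply/orP; right.
rewrite sumE chart2 in x2.
have {}x1 : `|E1 n + h11 n * (z' 0 0)%:~R + h12 n * (z' 1 0)%:~R| <= 8 * D1.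
  by rewrite -chart1 zm.
have r0 : 0 < r n by nra.
have b1 : `|E1 n| <= `|e1| + 1 by near: n.
have b2 : `|E2 n| <= `|e2| + 1 by near: n.
suff [] : `|(z' 0 0)%:~R : R| <= 2 * K * C /\ `|(z' 1 0)%:~R : R| <= 2 * K * C.
  exact: s'P.
apply: (large_det_bound pi1 (hdet n r0)).
- have : `|h11 n| <= `|g11| + 1 by near: n.
  have := normr_ge0 g12; have := normr_ge0 g21; have := normr_ge0 g22.
  by rewrite /K; lra.
- have : `|h12 n| <= `|g12| + 1 by near: n.
  have := normr_ge0 g11; have := normr_ge0 g21; have := normr_ge0 g22.
  by rewrite /K; lra.
- have : `|h21 n| <= `|g21| + 1 by near: n.
  have := normr_ge0 g12; have := normr_ge0 g11; have := normr_ge0 g22.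
  by rewrite /K; lra.
- have : `|h22 n| <= `|g22| + 1 by near: n.
  have := normr_ge0 g12; have := normr_ge0 g21; have := normr_ge0 g11.
  by rewrite /K; lra.
- have -> : h11 n * (z' 0 0)%:~R + h12 n * (z' 1 0)%:~R =
    (E1 n + h11 n * (z' 0 0)%:~R + h12 n * (z' 1 0)%:~R) - E1 n by ring.
  by apply: le_trans (ler_normB _ _) _; have := normr_ge0 e2; rewrite /C; lra.
- have -> : h21 n * (z' 0 0)%:~R + h22 n * (z' 1 0)%:~R =
    (E2 n + h21 n * (z' 0 0)%:~R + h22 n * (z' 1 0)%:~R) - E2 n by ring.
  by apply: le_trans (ler_normB _ _) _; have := normr_ge0 e1; rewrite /C; lra.
Unshelve. all: by end_near. Qed.

(** * The Chabauty limits *)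

(** The bound 1 on the last two entries is |d_j| q_{j+1} <= 1 together with
    q_j <= q_{j+1}. *)
Lemma cvgt_triple_bounded (R : realType) (alpha : R) :
  badly_approximable alpha -> exists2 B : R, 1 <= B & forall j,
  [/\ 1 <= (cvgt_triple alpha j).1.1 <= B,
      `|(cvgt_triple alpha j).1.2| <= 1 & `|(cvgt_triple alpha j).2| <= 1].
Proof.
move=> abad; have airr := abad.1.
have [B qB] := cvgt_den_ratio_bounded abad.
have q1 i := cvgt_den_ge1 i airr.
have q0 i : 0 < (cvgt_den alpha i)%:~R :> R by exact: lt_le_trans ltr01 (q1 i).
have q_le i : (cvgt_den alpha i)%:~R <= (cvgt_den alpha i.+1)%:~R :> R.
  by rewrite ler_int cvgt_den_homo.
have ratio i : 1 <= (cvgt_triple alpha i).1.1 <= B.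
  by rewrite /= ler_pdivlMr// mul1r ler_pdivrMr// q_le/= qB.
have err i : `|(cvgt_den alpha i)%:~R * cvgt_err alpha i| <= 1.
  rewrite normrM (gtr0_norm (q0 i)) mulrC; apply: le_trans (cvgt_err_le i airr).
  by rewrite ler_wpM2l.
exists B => [|i]; first by have /andP[/le_trans] := ratio 0%N; apply.
by split; [exact: ratio|exact: err|exact: err].
Qed.

(** The scale t is kept in [lo, hi] with lo > 0 because the chart matrix
    involves both t and 1 / t. The origins (m0, k0) of the coordinates are
    chosen by rounding, which bounds the offsets by the entries of the chart
    matrix, whatever the position of the centre. *)
Lemma spiral_patch_subseq (R : realType) (alpha lo hi M : R)
    (r phi : nat -> R) (j : nat -> nat) :
  badly_approximable alpha -> 0 < lo ->
  (forall n, 0 < r n) -> r n @[n --> \oo] --> +oo ->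
  (forall n, `|phi n| <= M) ->
  (forall n, lo <= (cvgt_den alpha (j n))%:~R / (2 * r n * Num.sqrt pi) <= hi) ->
  exists (f : nat -> nat) (beta c c' theta t : R) (w : 'cV[R]_2),
  [/\ increasing_seq f,
      cvgt_triple alpha (j (f n)) @[n --> \oo] --> (beta, c, c') /\
      phi (f n) @[n --> \oo] --> theta,
      (cvgt_den alpha (j (f n)))%:~R / (2 * r (f n) * Num.sqrt pi)
        @[n --> \oo] --> t /\ 0 < t,
      closed (translate w (spiral_lattice theta t beta c c')) &
      local_cvg (fun n => translate (- polar (r (f n)) (phi (f n)))
          (fermat_spiral alpha))
        (translate w (spiral_lattice theta t beta c c'))].
Proof.
move=> abad lo0 r0 roo phiM tlh; have airr := abad.1.
have [B B1 triB] := cvgt_triple_bounded abad.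
set sp := Num.sqrt pi in tlh *.
have sp0 : 0 <= sp by exact: sqrtr_ge0.
pose tau n := cvgt_triple alpha (j n).
pose t n := (cvgt_den alpha (j n))%:~R / (2 * r n * sp).
pose q n : R := (cvgt_den alpha (j n))%:~R.
pose q' n : R := (cvgt_den alpha (j n).+1)%:~R.
pose h21 n := 2 * pi * r n * cvgt_err alpha (j n).
pose h22 n := 2 * pi * r n * cvgt_err alpha (j n).+1.
have /choice[z zP] : forall n, exists z : 'cV[int]_2,
    `|- r n / 2 + q n / (2 * r n) * (z 0 0)%:~R + q' n / (2 * r n) * (z 1 0)%:~R|
      <= `|q n / (2 * r n)| + `|q' n / (2 * r n)| /\
    `|- (r n * phi n) + h21 n * (z 0 0)%:~R + h22 n * (z 1 0)%:~R|
      <= `|h21 n| + `|h22 n|.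
  move=> n; apply: lattice_rounding; rewrite -normr_gt0.
  by rewrite chart_det ?gt_eqF// pi_gt0.
pose m0 n := z n 0 0 * cvgt_den alpha (j n) + z n 1 0 * cvgt_den alpha (j n).+1.
pose k0 n := z n 0 0 * cvgt_num alpha (j n) + z n 1 0 * cvgt_num alpha (j n).+1.
pose E1 n := ((m0 n)%:~R - r n ^+ 2) / (2 * r n).
pose E2 n := r n * (2 * pi * (alpha * (m0 n)%:~R - (k0 n)%:~R) - phi n).
have E1B n : `|E1 n| <= sp * hi + sp * (hi * B).
  have /andP[tlo thi] := tlh n; have t0 := lt_le_trans lo0 tlo.
  have [h11E h12E _ _] := chart_matrixE (j n) airr (r0 n).
  have -> : E1 n = - r n / 2 + q n / (2 * r n) * (z n 0 0)%:~R +
      q' n / (2 * r n) * (z n 1 0)%:~R.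
    rewrite /E1 /m0 intrD !intrM /q /q'; field; by rewrite gt_eqF.
  apply: le_trans (zP n).1 _; rewrite /q /q' h11E h12E -/sp -/(t n) -/(tau n).
  have [/andP[b1 bB] _ _] := triB (j n); rewrite -/(tau n) in b1 bB.
  have b0 := le_trans ler01 b1; rewrite -/(t n) in t0 thi.
  move: (t n) (tau n).1.1 t0 thi b0 bB => x y /ltW x0 xhi y0 yB.
  by rewrite !ger0_norm ?mulr_ge0// lerD// ler_wpM2l// ler_pM.
have E2B n : `|E2 n| <= sp * lo^-1 + sp * lo^-1.
  have /andP[tlo thi] := tlh n; have t0 := lt_le_trans lo0 tlo.
  have [_ _ h21E h22E] := chart_matrixE (j n) airr (r0 n).
  have -> : E2 n = - (r n * phi n) + h21 n * (z n 0 0)%:~R +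
      h22 n * (z n 1 0)%:~R.
    by rewrite /E2 /m0 /k0 !intrD !intrM /h21 /h22 /cvgt_err; ring.
  apply: le_trans (zP n).2 _; rewrite /h21 /h22 h21E h22E -/sp -/(t n) -/(tau n).
  have [/andP[b1 bB] c1 c'1] := triB (j n); rewrite -/(tau n) in b1 bB c1 c'1.
  rewrite -/(t n) in t0 tlo.
  have b0 := lt_le_trans ltr01 b1.
  have tV : `|(t n)^-1| <= lo^-1 by rewrite gtr0_norm ?invr_gt0// lef_pV2.
  have bV : `|(tau n).1.1^-1| <= 1 by rewrite gtr0_norm ?invr_gt0// invf_le1.
  rewrite lerD// normrM (ger0_norm sp0) ler_wpM2l// normrM -[lo^-1]mul1r ler_pM//.
  by rewrite normrM -[1]mul1r ler_pM.
pose u i := nth (fun=> 0) [:: fun n => (tau n).1.1; fun n => (tau n).1.2;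
  fun n => (tau n).2; t; phi; E1; E2] i.
have [|f finc fcvg] := @bounded_subseq_cvg R 7 u.
  move=> i; case: i => [|[|[|[|[|[|[|i]]]]]]] i7; last by [].
  - exists B => n; have [/andP[b1 bB] _ _] := triB (j n).
    by rewrite ger0_norm// (le_trans ler01).
  - by exists 1 => n; have [_ c1 _] := triB (j n).
  - by exists 1 => n; have [_ _ c1] := triB (j n).
  - exists hi => n; have /andP[tlo thi] := tlh n.
    by rewrite ger0_norm// (le_trans (ltW lo0)).
  - by exists M.
  - by exists (sp * hi + sp * (hi * B)).
  - by exists (sp * lo^-1 + sp * lo^-1).
have /cvg_ex[beta betac] := fcvg 0%N isT; have /cvg_ex[c cc] := fcvg 1%N isT.
have /cvg_ex[c' c'c] := fcvg 2%N isT; have /cvg_ex[t' t'c] := fcvg 3%N isT.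
have /cvg_ex[theta thetac] := fcvg 4%N isT; have /cvg_ex[e1 e1c] := fcvg 5%N isT.
have /cvg_ex[e2 e2c] := fcvg 6%N isT.
have t'0 : 0 < t'.
  apply: lt_le_trans lo0 _; have /cvg_lim <- // := t'c.
  apply: limr_ge; first exact: cvgP t'c.
  by apply: nearW => n; have /andP[] := tlh (f n).
exists f, beta, c, c', theta, t', (rotation_mx theta *m col2 e1 e2).
have roof : r (f n) @[n --> \oo] --> +oo.
  by apply: cvg_comp roo; exact: increasing_seq_cvg_oo.
have [Ycl Ycvg] := spiral_patch_cvg (j := j \o f) (m0 := m0 \o f) (k0 := k0 \o f)
  airr roof thetac betac cc c'c t'c t'0 e1c e2c.
split=> //; split=> //.
exact: (cvg_pair (cvg_pair betac cc) c'c).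
Qed.

Lemma eucl_normN (R : realType) (d : nat) (x : 'cV[R]_d) :
  eucl_norm (- x) = eucl_norm x.
Proof. by congr Num.sqrt; apply: eq_bigr => i _; rewrite mxE sqrrN. Qed.

Lemma eucl_norm_polar (R : realType) (r phi : R) : eucl_norm (polar r phi) = `|r|.
Proof.
rewrite /eucl_norm big_ord_recl big_ord1 !mxE /= !exprMn -mulrDr cos2Dsin2.
by rewrite mulr1 sqrtr_sqr.
Qed.

(** The hypothesis of convergence identifies the limit only after the
    translations have been refined to a subsequence along which the scale, the
    triples and the offsets converge; the indices j must moreover be made
    strictly increasing for the triples to have a limit in the sense of the
    theorem. *)
Lemma chabauty_limit_is_lattice (R : realType) (alpha : R) (Y : set 'cV[R]_2) :
  badly_approximable alpha -> chabauty_limit (fermat_spiral alpha) Y ->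
  exists (beta c c' theta t : R) (w : 'cV[R]_2),
    [/\ cvgt_limit_set alpha (beta, c, c'), 0 < t &
        Y = translate w (spiral_lattice theta t beta c c')].
Proof.
move=> abad [_ Ycl [v [voo /chabauty_cvgP vY]]]; have airr := abad.1.
have [B B1 triB] := cvgt_triple_bounded abad.
pose sp : R := Num.sqrt pi.
have sp0 : 0 < sp by rewrite sqrtr_gt0 pi_gt0.
have /choice[phi phiP] : forall n, exists phi : R,
    `|phi| <= pi /\ - v n = polar (eucl_norm (v n)) phi.
  move=> n; have [x xpi vx] := polar_surj (- v n).
  by exists x; rewrite -eucl_normN.
pose r n := eucl_norm (v n).
have /choice[j jP] := fun n => cvgt_den_bracket (r n) airr.
have joo M : \forall n \near \oo, (M <= j n)%N.
  have : \forall n \near \oo, (cvgt_den alpha M)%:~R <= r n by exact: (cvgryPge r).1.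
  apply: filterS => n qr; rewrite leqNgt; apply/negP => jM.
  have := le_lt_trans qr (jP n).1.
  by rewrite ltNge ler_int cvgt_den_homo.
have r1oo : \forall n \near \oo, 1 <= r n by exact: (cvgryPge r).1.
have [g [ginc jginc r1]] := escaping_subseq joo r1oo.
have rgoo : r (g n) @[n --> \oo] --> +oo.
  by apply: cvg_comp voo; exact: increasing_seq_cvg_oo.
have [||||n|f [beta [c [c' [theta [t [w [finc [tric _] [_ t0] Y'cl Y'c]]]]]]]] :=
    @spiral_patch_subseq R alpha (2 * sp * B)^-1 (2 * sp)^-1 pi
      (r \o g) (phi \o g) (j \o g) abad.
- by rewrite invr_gt0 !mulr_gt0// (lt_le_trans ltr01).
- by move=> n; exact: lt_le_trans ltr01 (r1 n).
- exact: rgoo.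
- by move=> n; have [] := phiP (g n).
- have [rq /(_ (r1 n)) qr] := jP (g n).
  have r0 : 0 < r (g n) by exact: lt_le_trans ltr01 (r1 n).
  have B0 := lt_le_trans ltr01 B1.
  have q0 : 0 < (cvgt_den alpha (j (g n)))%:~R :> R.
    exact: lt_le_trans ltr01 (cvgt_den_ge1 _ airr).
  have [/andP[_]] := triB (j (g n)); rewrite /= ler_pdivrMr// => qB _ _.
  rewrite /= -/sp; move: (cvgt_den _ _)%:~R (cvgt_den _ _)%:~R (r (g n)) rq qr r0 q0 qB.
  move=> q q' x xq' qx x0 q0 q'B; apply/andP; split.
    rewrite ler_pdivlMr ?mulr_gt0//.
    have -> : (2 * sp * B)^-1 * (2 * x * sp) = x / B by field; rewrite !gt_eqF.
    by rewrite ler_pdivrMr// mulrC ltW// (lt_le_trans xq').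
  rewrite ler_pdivrMr ?mulr_gt0//.
  by have -> : (2 * sp)^-1 * (2 * x * sp) = x by field; rewrite gt_eqF.
exists beta, c, c', theta, t, w; split=> //.
  exists (j \o g \o f); split=> // a b.
  by rewrite (jginc (f a) (f b)) -leEnat finc.
apply: (local_cvg_unique Ycl Y'cl _ Y'c).
have gfinc : increasing_seq (g \o f) by move=> a b; rewrite /= ginc -leEnat finc.
have := local_cvg_subseq gfinc vY.
congr local_cvg; apply/funext => n /=.
by rewrite -(phiP _).2 opprK.
Qed.

(** The offset w' of the limit at the points r e^(i theta) is not under
    control, but shifting these translations by the fixed vector w - w' turns
    it into w and still sends the origin to infinity. *)
Lemma lattice_is_chabauty_limit (R : realType) (alpha : R)
    (beta c c' theta t : R) (w : 'cV[R]_2) :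
  badly_approximable alpha -> cvgt_limit_set alpha (beta, c, c') -> 0 < t ->
  chabauty_limit (fermat_spiral alpha)
    (translate w (spiral_lattice theta t beta c c')).
Proof.
move=> abad [k [kinc kc]] t0; have airr := abad.1.
pose sp : R := Num.sqrt pi.
have sp0 : 0 < sp by rewrite sqrtr_gt0 pi_gt0.
pose r n := (cvgt_den alpha (k n))%:~R / (2 * t * sp).
(* This radius makes the scale at index k n equal to t for every n. *)
have q0 i : 0 < (cvgt_den alpha i)%:~R :> R.
  exact: lt_le_trans ltr01 (cvgt_den_ge1 _ airr).
have r0 n : 0 < r n by rewrite divr_gt0// !mulr_gt0.
have tE n : (cvgt_den alpha (k n))%:~R / (2 * r n * sp) = t.
  rewrite /r; move: (cvgt_den _ _)%:~R (q0 (k n)) => q qp.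
  by field; rewrite !gt_eqF.
have roo : r n @[n --> \oo] --> +oo.
  apply/cvgryPge => A.
  have : \forall n \near \oo, A * (2 * t * sp) <= n%:R by exact: nbhs_infty_ger.
  apply: filterS => n An; rewrite /r ler_pdivlMr ?mulr_gt0//.
  apply: le_trans An _; rewrite -[n%:R]/(n%:Z%:~R) ler_int.
  by apply: le_trans (cvgt_den_ge (k n) airr); rewrite lez_nat increasing_seq_ge.
have [n|n|f [beta' [c1 [c1' [theta' [t' [w' [finc [tric thetac] [tc _] Ycl Yc]]]]]]]] :=
    @spiral_patch_subseq R alpha t t `|theta| r (fun=> theta) k abad t0 r0 roo.
- by [].
- by rewrite tE !lexx.
have tric0 : cvgt_triple alpha (k (f n)) @[n --> \oo] --> (beta, c, c').
  by apply: cvg_comp kc; exact: increasing_seq_cvg_oo.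
have [bE cE c'E] : (beta', c1, c1') = (beta, c, c').
  exact: (cvg_unique (@norm_hausdorff _ _) tric tric0).
have thetaE : theta' = theta.
  exact: (cvg_unique (@Rhausdorff R) thetac (cvg_cst theta)).
have t'E : t' = t.
  apply: (cvg_unique (@Rhausdorff R) tc); rewrite /= -/sp.
  by under eq_cvg do rewrite tE; exact: cvg_cst.
rewrite {}bE {}cE {}c'E {}thetaE {}t'E {tric thetac tc} in Ycl Yc.
have YE : translate w (spiral_lattice theta t beta c c') =
    translate (w - w') (translate w' (spiral_lattice theta t beta c c')).
  by rewrite translateD subrK.
rewrite YE; split; [exact: fermat_spiral_closed|exact: closed_translate|].
exists (fun n => (w - w') - polar (r (f n)) theta); split; last first.
  apply/chabauty_cvgP; have := local_cvg_translate (w - w') Yc.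
  by congr local_cvg; apply/funext => n; rewrite translateD.
apply/cvgryPge => A.
have : \forall n \near \oo, 2 * (A + `|w - w'|) <= r (f n).
  apply: (cvgryPge (r \o f)).1.
  by apply: cvg_comp roo; exact: increasing_seq_cvg_oo.
apply: filterS => n rA; apply: le_trans (normr_le_eucl_norm _).
have := eucl_norm_le_normr (polar (r (f n)) theta).
rewrite eucl_norm_polar gtr0_norm//.
set P := polar _ _ => polar_ge; set W := w - w' in rA *.
have := ler_normB W (W - P).
by have -> : W - (W - P) = P by [rewrite opprB addrC subrK]; lra.
Qed.

Theorem theorem2 (R : realType) (alpha : R) (halpha : badly_approximable alpha)
    (Y : set 'cV[R]_2) :
  chabauty_limit (fermat_spiral alpha) Y <->
  exists (beta c c' theta t : R) (w : 'cV[R]_2),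
    [/\ cvgt_limit_set alpha (beta, c, c'), 0 < t &
        Y = translate w (spiral_lattice theta t beta c c')].
Proof.
split=> [|[beta [c [c' [theta [t [w [tri t0 ->]]]]]]]].
  exact: chabauty_limit_is_lattice.
exact: lattice_is_chabauty_limit.
Qed.
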